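(* Let $f(z)=z+a_2z^2+a_3z^3+\cdots\in\mathcal{C}_{\arcsin}$. Then $$|a_2a_3-a_4|\le \frac{1}{6\pi}.$$ The inequality is sharp, i.e. there is a function in $\mathcal{C}_{\arcsin}$ for which equality holds.
   Context: Let $\Omega=\{z\in\mathbb{C}:|z|<1\}$. Let $\mathcal{A}$ be the family of analytic functions $f$ in $\Omega$ normalized by $f(z)=z+\sum_{n=2}^{\infty}a_nz^n$, and let $\mathcal{S}\subset\mathcal{A}$ be the subclass of univalent functions. A Schwarz function is an analytic $\omega:\Omega\to\mathbb{C}$ with $\omega(0)=0$ and $|\omega(z)|\le 1$ on $\Omega$. For analytic $g,h$ in $\Omega$, $g\prec h$ (subordination) means that there is a Schwarz function $\omega$ with $g(z)=h(\omega(z))$ for all $z\in\Omega$. With $\arcsin$ the principal branch ($\arcsin 0=0$), define $$\mathcal{C}_{\arcsin}=\left\{f\in\mathcal{S}:\ 1+\frac{zf''(z)}{f'(z)}\prec 1+\frac{2}{\pi}\arcsin z \text{ in } \Omega\right\}.$$ *)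

(* Defs.v *)
From Stdlib Require Import Reals.
From Coquelicot Require Import Coquelicot.

Open Scope R_scope.

Definition unit_disc (z : C) : Prop := Cmod z < 1.

(* Analytic is meant as complex differentiable at every point of the disc. *)
Definition analytic_on_disc (f : C -> C) : Prop :=
  forall z : C, unit_disc z ->
    ex_derive (K := C_AbsRing) (V := C_NormedModule) f z.

Definition schwarz_function (w : C -> C) : Prop :=
  analytic_on_disc w /\ w (RtoC 0) = RtoC 0 /\
  (forall z : C, unit_disc z -> Cmod (w z) <= 1).

Definition subordinate (g h : C -> C) : Prop :=
  exists w : C -> C, schwarz_function w /\
    (forall z : C, unit_disc z -> g z = h (w z)).

Definition normalized_expansion (f : C -> C) (a : nat -> C) : Prop :=
  a 0%nat = RtoC 0 /\ a 1%nat = RtoC 1 /\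
  (forall z : C, unit_disc z ->
    is_pseries (K := C_AbsRing) (V := C_NormedModule) a z (f z)).

Definition class_A (f : C -> C) : Prop :=
  analytic_on_disc f /\ (exists a : nat -> C, normalized_expansion f a).

Definition univalent_on_disc (f : C -> C) : Prop :=
  forall z1 z2 : C, unit_disc z1 -> unit_disc z2 -> f z1 = f z2 -> z1 = z2.

Definition class_S (f : C -> C) : Prop := class_A f /\ univalent_on_disc f.

(* Principal argument, in (-PI, PI]; the value at 0 is irrelevant. *)
Definition Carg (z : C) : R :=
  if Rle_dec 0 (Im z) then acos (Re z / Cmod z) else - acos (Re z / Cmod z).

Definition Clog (z : C) : C := (ln (Cmod z), Carg z).

(* The square root with argument in (-PI/2, PI/2]. *)
Definition Csqrt (z : C) : C :=
  (sqrt ((Cmod z + Re z) / 2),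
   if Rle_dec 0 (Im z) then sqrt ((Cmod z - Re z) / 2)
   else - sqrt ((Cmod z - Re z) / 2)).

(* Principal branch: arcsin z = -i Log (i z + sqrt (1 - z^2)). *)
Definition Carcsin (z : C) : C :=
  (- Ci * Clog (Ci * z + Csqrt (RtoC 1 - z * z)))%C.

(* The inverse of a zero of f' is a default value here, but f' has no zero in
   the disc when f is univalent. *)
Definition class_C_arcsin (f : C -> C) : Prop :=
  class_S f /\
  subordinate
    (fun z => 1 + z * C_derive (C_derive f) z / C_derive f z)%C
    (fun z => 1 + RtoC (2 / PI) * Carcsin z)%C.

(* Main.v *)
Require Import Defs.
From Stdlib Require Import Reals Ranalysis5 Lra Lia Psatz Wf_nat FunctionalExtensionality.
From Coquelicot Require Import Coquelicot.

Open Scope R_scope.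

(** Put [b = 2 / PI] and write the Schwarz function as [w z = c1 z + c2 z^2 + c3 z^3 + ...].
    Comparing coefficients in [z f'' / f' = b arcsin w] gives
    [a2 a3 - a4 = - (b / 12) (c3 + (b / 2) c1 c2 + (1 / 6 - b^2 / 2) c1^3]), and the bracket
    has modulus at most 1 as soon as [|c1|^2 + |c2|^2 + |c3|^2 <= 1].  This last inequality is
    Bessel's inequality for the bounded function [w] on circles of radius tending to 1.
    Since [w = sin (z f'' / (b f'))] with [f'] a nonvanishing power series, [w] is twice
    complex differentiable, so circle means can be differentiated under the integral sign
    and no general Cauchy theory is needed.

    Equality holds for [w z = z^3].  The corresponding [g = f'] solves [z g' = b g arcsin (z^3)];
    its coefficients are nonnegative with sum at most [9 / 5], so [|f' - 1| <= 4 / 5] and [f] is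
    univalent. *)

(** * Complex derivatives and complex series *)

(** A Schwarz function is assumed differentiable only once, which gives neither Taylor coefficients
    nor a continuous derivative without Cauchy's theorem. Inverting the subordination avoids this:
    the sine undoes the principal arcsine at every point of the plane, also on its cuts, so [w]
    becomes an explicit expression in the power series of f' and f'' and inherits their smoothness.
    This needs f' to have no zeros, and the subordination itself supplies that: the arcsine is
    bounded on the closed unit disc, so |z f''| <= K |f'|, and such an inequality keeps f' away from
    0 along every radius. In the final estimate PI > 3 makes the weights of c1 c2 and c1^3 so small
    that Bessel's inequality, which ignores all finer relations between the coefficients, is enough.
    For sharpness the obstacle is the branch: the power series of arcsin (z^3) has to be identified
    with the principal value, through exponentials and an intermediate value argument. Its
    coefficients sum to PI / 2; the rational bound 2 leaves enough room for univalence. *)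

Notation cder := (@is_derive C_AbsRing C_NormedModule).
Notation cseries := (@is_series C_AbsRing C_NormedModule).

(** The filter definition quantifies over all limit points of [locally z]; the only one is [z], so a
    single epsilon-delta estimate remains. *)
Lemma cder_eps (f : C -> C) (z l : C) :
  cder f z l <->
  forall eps, 0 < eps -> exists d, 0 < d /\ forall y, Cmod (y - z) < d ->
    Cmod (f y - f z - (y - z) * l) <= eps * Cmod (y - z).
Proof.
split.
- intros [_ H] eps He.
  destruct (H z (fun P HP => HP) (mkposreal eps He)) as [d Hd].
  exists d; split; [apply cond_pos|]. intros y Hy. exact (Hd y Hy).
- intros H. split; [exact (is_linear_scal_l (K:=C_AbsRing) (V:=C_NormedModule) l)|].
  intros x Hx eps.
  assert (E : z = x).
  { apply (@is_filter_lim_locally_unique C_AbsRing (AbsRing_NormedModule C_AbsRing)). exact Hx. }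
  subst x.
  destruct (H eps (cond_pos eps)) as [d [Hd H1]].
  exists (mkposreal d Hd). intros y Hy. exact (H1 y Hy).
Qed.

Lemma rder_eps (f : R -> R) (t l : R) :
  is_derive f t l <->
  forall eps, 0 < eps -> exists d, 0 < d /\ forall y, Rabs (y - t) < d ->
    Rabs (f y - f t - (y - t) * l) <= eps * Rabs (y - t).
Proof.
split.
- intros [_ H] eps He.
  destruct (H t (fun P HP => HP) (mkposreal eps He)) as [d Hd].
  exists d; split; [apply cond_pos|]. intros y Hy. exact (Hd y Hy).
- intros H. split; [exact (is_linear_scal_l (K:=R_AbsRing) (V:=R_NormedModule) l)|].
  intros x Hx eps.
  assert (E : t = x).
  { apply (@is_filter_lim_locally_unique R_AbsRing R_NormedModule). exact Hx. }
  subst x.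
  destruct (H eps (cond_pos eps)) as [d [Hd H1]].
  exists (mkposreal d Hd). intros y Hy. exact (H1 y Hy).
Qed.

Lemma cder_eq (f : C -> C) (z l l' : C) : cder f z l -> l = l' -> cder f z l'.
Proof. now intros H <-. Qed.

Lemma cder_const (c z : C) : cder (fun _ => c) z (RtoC 0).
Proof. exact (@is_derive_const C_AbsRing C_NormedModule c z). Qed.

(* [C_AbsRing] carries two normed module structures over itself, which have the
   same norm but are not convertible. *)
Lemma cder_AbsRing (f : C -> C) z l :
  @is_derive C_AbsRing (AbsRing_NormedModule C_AbsRing) f z l <-> cder f z l.
Proof.
split; intros [[L1 L2 L3] H]; (split; [constructor; [exact L1|exact L2|exact L3]|exact H]).
Qed.

Lemma cder_id (z : C) : cder (fun y => y) z (RtoC 1).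
Proof. apply cder_AbsRing. exact (@is_derive_id C_AbsRing z). Qed.

Lemma cder_plus (f g : C -> C) z a b :
  cder f z a -> cder g z b -> cder (fun y => f y + g y)%C z (a + b)%C.
Proof. exact (@is_derive_plus C_AbsRing C_NormedModule f g z a b). Qed.

Lemma cder_opp (f : C -> C) z a :
  cder f z a -> cder (fun y => - f y)%C z (- a)%C.
Proof. exact (@is_derive_opp C_AbsRing C_NormedModule f z a). Qed.

Lemma cder_minus (f g : C -> C) z a b :
  cder f z a -> cder g z b -> cder (fun y => f y - g y)%C z (a - b)%C.
Proof. exact (@is_derive_minus C_AbsRing C_NormedModule f g z a b). Qed.

Lemma cder_mult (f g : C -> C) z a b :
  cder f z a -> cder g z b -> cder (fun y => f y * g y)%C z (a * g z + f z * b)%C.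
Proof.
rewrite <- !cder_AbsRing. intros Hf Hg.
exact (@is_derive_mult C_AbsRing f g z a b Hf Hg Cmult_comm).
Qed.

Lemma cder_scal (c : C) (f : C -> C) z a :
  cder f z a -> cder (fun y => c * f y)%C z (c * a)%C.
Proof.
intros H. eapply cder_eq. apply (cder_mult (fun _ => c) f). apply cder_const. exact H. ring.
Qed.

Lemma cder_comp (f g : C -> C) z a b :
  cder f (g z) a -> cder g z b -> cder (fun y => f (g y)) z (b * a)%C.
Proof.
intros Hf Hg. apply cder_AbsRing in Hg.
exact (@is_derive_comp C_AbsRing C_NormedModule f g z a b Hf Hg).
Qed.

Lemma cder_continuous (f : C -> C) z l :
  cder f z l -> forall eps, 0 < eps ->
  exists d, 0 < d /\ forall y, Cmod (y - z) < d -> Cmod (f y - f z) < eps.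
Proof.
intros H eps He. rewrite cder_eps in H.
destruct (H 1 Rlt_0_1) as [d [Hd H1]].
assert (Hl := Cmod_ge_0 l).
exists (Rmin d (eps / (2 + Cmod l))). split.
{ apply Rmin_pos; [easy|]. apply Rdiv_lt_0_compat; lra. }
intros y Hy.
assert (H2 : Cmod (y - z) < d) by (eapply Rlt_le_trans; [exact Hy|apply Rmin_l]).
assert (H3 : Cmod (y - z) < eps / (2 + Cmod l)) by (eapply Rlt_le_trans; [exact Hy|apply Rmin_r]).
specialize (H1 y H2).
replace (f y - f z)%C with ((f y - f z - (y - z) * l) + (y - z) * l)%C by ring.
eapply Rle_lt_trans; [apply Cmod_triangle|]. rewrite Cmod_mult.
assert (H4 := Cmod_ge_0 (y - z)).
apply (Rmult_lt_compat_r (2 + Cmod l)) in H3; [|lra].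
unfold Rdiv in H3. rewrite Rmult_assoc, Rinv_l, Rmult_1_r in H3 by lra.
nra.
Qed.

Lemma cder_inv (f : C -> C) z l :
  cder f z l -> f z <> RtoC 0 -> cder (fun y => / f y)%C z (- l / (f z * f z))%C.
Proof.
intros Hf Hz.
assert (Hinv : cder Cinv (f z) (- / (f z * f z))%C).
{ set (w := f z) in *. apply cder_eps. intros eps He.
  assert (Hw : 0 < Cmod w) by now apply Cmod_gt_0.
  assert (HW : 0 < Cmod w ^ 3) by (apply pow_lt; lra).
  (* The first bound keeps |y| > |w| / 2; the remainder |y - w|^2 / (|w|^2 |y|) is then at most 2 |y
     - w|^2 / |w|^3, which the second bound makes small. *)
  exists (Rmin (Cmod w / 2) (eps * (Cmod w ^ 3 / 2))). split.
  { apply Rmin_pos; [lra|]. apply Rmult_lt_0_compat; lra. }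
  intros y Hy.
  assert (H2 : Cmod (y - w) < Cmod w / 2) by (eapply Rlt_le_trans; [exact Hy|apply Rmin_l]).
  assert (H3 : Cmod (y - w) < eps * (Cmod w ^ 3 / 2)) by (eapply Rlt_le_trans; [exact Hy|apply Rmin_r]).
  assert (H4 : Cmod w / 2 < Cmod y).
  { assert (Cmod w <= Cmod (w - y) + Cmod y).
    { replace w with ((w - y) + y)%C at 1 by ring. apply Cmod_triangle. }
    replace (w - y)%C with (- (y - w))%C in H by ring. rewrite Cmod_opp in H. lra. }
  assert (Hy0 : y <> RtoC 0) by (apply Cmod_gt_0; lra).
  replace (/ y - / w - (y - w) * - / (w * w))%C with ((y - w) * ((y - w) * / (w * w * y)))%C
    by (field; auto).
  rewrite !Cmod_mult, Cmod_inv, !Cmod_mult by (repeat apply Cmult_neq_0; auto).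
  rewrite (Rmult_comm eps). apply Rmult_le_compat_l; [apply Cmod_ge_0|].
  set (a := Cmod w) in *. set (b := Cmod y) in *.
  assert (Hab : 0 < a * a * b) by (repeat apply Rmult_lt_0_compat; lra).
  apply (Rmult_le_reg_r (a * a * b)); [easy|].
  rewrite Rmult_assoc, Rinv_l, Rmult_1_r by lra.
  apply Rlt_le. eapply Rlt_le_trans; [exact H3|].
  apply Rmult_le_compat_l; [lra|]. simpl. nra. }
eapply cder_eq. apply (cder_comp Cinv f z _ _ Hinv Hf).
field. exact Hz.
Qed.

Lemma cder_div (f g : C -> C) z a b :
  cder f z a -> cder g z b -> g z <> RtoC 0 ->
  cder (fun y => f y / g y)%C z ((a * g z - f z * b) / (g z * g z))%C.
Proof.
intros Hf Hg Hz. eapply cder_eq.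
apply (cder_mult f (fun y => / g y)%C). exact Hf. apply cder_inv; eassumption.
field. exact Hz.
Qed.

Lemma cder_pow (n : nat) (z : C) :
  cder (fun y => y ^ S n)%C z (RtoC (INR (S n)) * z ^ n)%C.
Proof.
induction n as [|n IH].
- eapply cder_eq. apply (is_derive_ext (K:=C_AbsRing) (V:=C_NormedModule) (fun y : C => y)).
  intros t; simpl. exact (eq_sym (Cmult_1_r t)). apply cder_id. simpl. ring.
- eapply cder_eq.
  apply (cder_mult (fun y => y) (fun y => y ^ S n)%C). apply cder_id. exact IH.
  rewrite (S_INR (S n)), RtoC_plus. simpl Cpow. ring.
Qed.

Lemma cder_ext_loc (f g : C -> C) z l r :
  0 < r -> (forall y, Cmod (y - z) < r -> f y = g y) -> cder f z l -> cder g z l.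
Proof.
intros Hr H Hf.
apply (is_derive_ext_loc (K:=C_AbsRing) (V:=C_NormedModule) f g); [|exact Hf].
exists (mkposreal r Hr). intros y Hy. apply H. exact Hy.
Qed.

(** * Curves in the plane and the mean value inequality *)

(** Stated as the same kind of estimate as [cder_eps], so that the chain rule with a complex
    derivative is a direct computation. Real parts then give the real derivatives to which the mean
    value theorem and parameter integrals apply. *)
Definition curve_der (g : R -> C) (t : R) (v : C) : Prop :=
  forall eps, 0 < eps -> exists d, 0 < d /\ forall s, Rabs (s - t) < d ->
    Cmod (g s - g t - RtoC (s - t) * v) <= eps * Rabs (s - t).

Lemma Rabs_snd_le_Cmod (z : C) : Rabs (Im z) <= Cmod z.
Proof. eapply Rle_trans; [apply Rmax_r|apply Rmax_Cmod]. Qed.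

Lemma Cmod_le_Rabs (z : C) : Cmod z <= Rabs (Re z) + Rabs (Im z).
Proof.
assert (E : z = (RtoC (Re z) + RtoC (Im z) * Ci)%C).
{ destruct z as [x y]. unfold RtoC, Ci, Cplus, Cmult, Re, Im; simpl. f_equal; ring. }
rewrite E at 1.
eapply Rle_trans; [apply Cmod_triangle|].
rewrite Cmod_mult, Cmod_Ci, !Cmod_R, Rmult_1_r. lra.
Qed.

Lemma curve_der_pair (x y : R -> R) t a b :
  is_derive x t a -> is_derive y t b -> curve_der (fun s => (x s, y s)) t (a, b).
Proof.
intros Hx Hy eps He. rewrite rder_eps in Hx, Hy.
destruct (Hx (eps / 2)) as [d1 [Hd1 H1]]; [lra|].
destruct (Hy (eps / 2)) as [d2 [Hd2 H2]]; [lra|].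
exists (Rmin d1 d2); split; [now apply Rmin_pos|]. intros s Hs.
specialize (H1 s (Rlt_le_trans _ _ _ Hs (Rmin_l _ _))).
specialize (H2 s (Rlt_le_trans _ _ _ Hs (Rmin_r _ _))).
eapply Rle_trans; [apply Cmod_le_Rabs|].
unfold RtoC, Cminus, Cplus, Copp, Cmult, Re, Im; simpl.
match goal with |- Rabs ?A + Rabs ?B <= _ =>
  replace A with (x s - x t - (s - t) * a) by ring;
  replace B with (y s - y t - (s - t) * b) by ring end.
lra.
Qed.

Lemma curve_der_comp (f : C -> C) (g : R -> C) t l v :
  cder f (g t) l -> curve_der g t v -> curve_der (fun s => f (g s)) t (v * l)%C.
Proof.
intros Hf Hg eps He. rewrite cder_eps in Hf.
assert (Hv := Cmod_ge_0 v). assert (Hl := Cmod_ge_0 l).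
(* The remainder of [f] costs e1 (1 + |v|) = eps / 2 and that of [g], multiplied by |l|, another eps
   / 2. The cap 1 on [e2] yields |g s - g t| <= (1 + |v|) |s - t|. *)
set (e1 := eps / (2 * (1 + Cmod v))).
set (e2 := Rmin 1 (eps / (2 * (1 + Cmod l)))).
assert (He1 : 0 < e1) by (apply Rdiv_lt_0_compat; lra).
assert (He2 : 0 < e2) by (apply Rmin_pos; [lra|apply Rdiv_lt_0_compat; lra]).
destruct (Hf e1 He1) as [d1 [Hd1 H1]].
destruct (Hg e2 He2) as [d2 [Hd2 H2]].
exists (Rmin d2 (d1 / (1 + Cmod v))); split.
{ apply Rmin_pos; [easy|apply Rdiv_lt_0_compat; lra]. }
intros s Hs.
specialize (H2 s (Rlt_le_trans _ _ _ Hs (Rmin_l _ _))).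
assert (H3 := Rlt_le_trans _ _ _ Hs (Rmin_r _ _)).
assert (Hst := Rabs_pos (s - t)).
assert (He21 : e2 <= 1) by apply Rmin_l.
assert (He22 : e2 <= eps / (2 * (1 + Cmod l))) by apply Rmin_r.
assert (H4 : Cmod (g s - g t) <= (1 + Cmod v) * Rabs (s - t)).
{ replace (g s - g t)%C with ((g s - g t - RtoC (s - t) * v) + RtoC (s - t) * v)%C by ring.
  eapply Rle_trans; [apply Cmod_triangle|]. rewrite Cmod_mult, Cmod_R. nra. }
assert (H5 : Cmod (g s - g t) < d1).
{ eapply Rle_lt_trans; [exact H4|].
  apply (Rmult_lt_compat_l (1 + Cmod v)) in H3; [|lra].
  replace ((1 + Cmod v) * (d1 / (1 + Cmod v))) with d1 in H3 by (field; lra). exact H3. }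
specialize (H1 (g s) H5).
replace (f (g s) - f (g t) - RtoC (s - t) * (v * l))%C
  with ((f (g s) - f (g t) - (g s - g t) * l) + (g s - g t - RtoC (s - t) * v) * l)%C by ring.
eapply Rle_trans; [apply Cmod_triangle|]. rewrite Cmod_mult.
assert (H6 : e1 * Cmod (g s - g t) <= eps / 2 * Rabs (s - t)).
{ eapply Rle_trans. apply Rmult_le_compat_l; [lra|exact H4].
  apply Req_le. unfold e1. field. lra. }
assert (H7 : Cmod (g s - g t - RtoC (s - t) * v) * Cmod l <= eps / 2 * Rabs (s - t)).
{ eapply Rle_trans. apply Rmult_le_compat_r; [lra|exact H2].
  assert (e2 * Cmod l <= eps / 2).
  { eapply Rle_trans. apply Rmult_le_compat_r; [lra|exact He22].
    apply (Rmult_le_reg_r (2 * (1 + Cmod l))); [lra|].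
    replace (eps / (2 * (1 + Cmod l)) * Cmod l * (2 * (1 + Cmod l))) with (eps * Cmod l) by (field; lra).
    nra. }
  nra. }
lra.
Qed.

Lemma curve_der_Re (g : R -> C) t v : curve_der g t v -> is_derive (fun s => Re (g s)) t (Re v).
Proof.
intros H. apply rder_eps. intros eps He.
destruct (H eps He) as [d [Hd H1]]. exists d; split; [easy|]. intros s Hs.
eapply Rle_trans; [|apply (H1 s Hs)].
eapply Rle_trans; [|apply re_le_Cmod].
apply Req_le. f_equal. unfold RtoC, Cminus, Cplus, Copp, Cmult, Re, Im; simpl. ring.
Qed.

Lemma curve_der_segment (z0 v : C) t : curve_der (fun s => z0 + RtoC s * v)%C t v.
Proof.
intros eps He. exists 1; split; [lra|]. intros s Hs.
replace (z0 + RtoC s * v - (z0 + RtoC t * v) - RtoC (s - t) * v)%C with (RtoC 0)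
  by (rewrite RtoC_minus; ring).
rewrite Cmod_0. assert (H := Rabs_pos (s - t)). nra.
Qed.

Lemma Re_mult_conj (z : C) : Re (Cconj z * z) = Cmod z ^ 2.
Proof. rewrite Cmod2_alt. unfold Cconj, Cmult, Re, Im; simpl. ring. Qed.

(** The mean value theorem has no equality form for complex values, so it is applied to the real
    function Re (conj D F) along the segment, where D = F z1 - F z0. The increment of this function
    is |D|^2, and one factor |D| cancels. *)
Lemma mean_value_ineq (F F' : C -> C) (z0 z1 : C) (L : R) :
  (forall t, 0 <= t <= 1 -> cder F (z0 + RtoC t * (z1 - z0))%C (F' (z0 + RtoC t * (z1 - z0))%C) /\
     Cmod (F' (z0 + RtoC t * (z1 - z0))%C) <= L) ->
  Cmod (F z1 - F z0) <= L * Cmod (z1 - z0).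
Proof.
intros H.
set (D := (F z1 - F z0)%C).
set (g := fun s : R => (z0 + RtoC s * (z1 - z0))%C).
set (h := fun s => Re (Cconj D * F (g s))%C).
assert (Hd : forall t, 0 <= t <= 1 -> is_derive h t (Re ((z1 - z0) * (Cconj D * F' (g t))))).
{ intros t Ht. apply curve_der_Re.
  apply (curve_der_comp (fun y => Cconj D * F y)%C g).
  apply cder_scal. apply H; exact Ht. apply curve_der_segment. }
destruct (MVT_gen h 0 1 (fun t => Re ((z1 - z0) * (Cconj D * F' (g t))))) as [c [Hc E]].
- rewrite Rmin_left, Rmax_right by lra. intros x Hx. apply Hd; lra.
- rewrite Rmin_left, Rmax_right by lra. intros x Hx.
  apply continuity_pt_filterlim. apply (ex_derive_continuous (K:=R_AbsRing) h).
  eexists; apply Hd; lra.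
- rewrite Rmin_left, Rmax_right in Hc by lra.
  assert (E2 : h 1 - h 0 = Cmod D ^ 2).
  { unfold h, g. rewrite <- Re_mult_conj.
    replace (z0 + RtoC 1 * (z1 - z0))%C with z1 by ring.
    replace (z0 + RtoC 0 * (z1 - z0))%C with z0 by ring.
    unfold D. unfold Cconj, Cminus, Copp, Cplus, Cmult, Re, Im; simpl. ring. }
  rewrite E2 in E.
  assert (HD := Cmod_ge_0 D).
  assert (B : Cmod D ^ 2 <= Cmod D * (L * Cmod (z1 - z0))).
  { rewrite E. eapply Rle_trans; [apply Rle_abs|]. rewrite Rabs_mult.
    replace (Rabs (1 - 0)) with 1 by (rewrite Rminus_0_r, Rabs_R1; reflexivity).
    rewrite Rmult_1_r. eapply Rle_trans; [apply re_le_Cmod|].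
    rewrite !Cmod_mult, Cmod_conj.
    destruct (H c Hc) as [_ HL]. fold (g c) in HL.
    assert (0 <= Cmod (z1 - z0) * Cmod D) by (apply Rmult_le_pos; apply Cmod_ge_0).
    nra. }
  destruct (Req_dec (Cmod D) 0) as [Z|Z].
  + rewrite Z. destruct (H c Hc) as [_ HL].
    apply Rmult_le_pos; [|apply Cmod_ge_0].
    eapply Rle_trans; [apply Cmod_ge_0|exact HL].
  + apply (Rmult_le_reg_l (Cmod D)); [lra|]. simpl in B. lra.
Qed.

(** * Complex series *)

Lemma sum_n_Re (u : nat -> C) n :
  Re (sum_n (G:=C_AbelianMonoid) u n) = sum_n (fun k => Re (u k)) n.
Proof.
induction n as [|n IH]; [now rewrite !sum_O|]. rewrite !sum_Sn, <- IH. reflexivity.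
Qed.

Lemma sum_n_Im (u : nat -> C) n :
  Im (sum_n (G:=C_AbelianMonoid) u n) = sum_n (fun k => Im (u k)) n.
Proof.
induction n as [|n IH]; [now rewrite !sum_O|]. rewrite !sum_Sn, <- IH. reflexivity.
Qed.

Lemma cseries_Re_Im (u : nat -> C) (l : C) :
  cseries u l <-> is_series (fun n => Re (u n)) (Re l) /\ is_series (fun n => Im (u n)) (Im l).
Proof.
split.
- intros H. assert (H' := proj1 (@filterlim_locally nat C_UniformSpace eventually _
    (sum_n (G:=C_AbelianMonoid) u) l) H).
  split; apply (proj2 (filterlim_locally (U:=R_UniformSpace) _ _)); intros eps; destruct (H' eps) as [N HN]; exists N; intros n Hn;
  destruct (HN n Hn) as [H1 H2].
  + rewrite <- sum_n_Re. exact H1.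
  + rewrite <- sum_n_Im. exact H2.
- intros [H1 H2]. refine (proj2 (@filterlim_locally nat C_UniformSpace eventually _
    (sum_n (G:=C_AbelianMonoid) u) l) _). intros eps.
  assert (F : forall v m, is_series v m -> forall e : posreal,
    eventually (fun n => ball m e (sum_n (G:=R_AbelianMonoid) v n))).
  { intros v m Hv. exact (proj1 (@filterlim_locally nat R_UniformSpace eventually _
      (sum_n (G:=R_AbelianMonoid) v) m) Hv). }
  apply F with (e := eps) in H1, H2.
  destruct H1 as [N1 HN1]. destruct H2 as [N2 HN2].
  exists (Nat.max N1 N2). intros n Hn. split.
  + generalize (HN1 n ltac:(lia)). rewrite <- sum_n_Re. exact (fun x => x).
  + generalize (HN2 n ltac:(lia)). rewrite <- sum_n_Im. exact (fun x => x).
Qed.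

Lemma cseries_abs (u : nat -> C) :
  ex_series (fun n => Cmod (u n)) -> exists l, cseries u l.
Proof.
intros H. apply (ex_series_le (K:=C_AbsRing) (V:=C_CompleteNormedModule) u (fun n => Cmod (u n))).
intros n. apply Rle_refl. exact H.
Qed.

Lemma cseries_unique (u : nat -> C) (l1 l2 : C) : cseries u l1 -> cseries u l2 -> l1 = l2.
Proof.
rewrite !cseries_Re_Im. intros [H1 H2] [H3 H4].
apply is_series_unique in H1, H2, H3, H4.
apply injective_projections; unfold Re, Im in *; congruence.
Qed.

Lemma cseries_norm_le (u : nat -> C) (v : nat -> R) (l : C) (m : R) :
  cseries u l -> is_series v m -> (forall n, Cmod (u n) <= v n) -> Cmod l <= m.
Proof.
intros Hu Hv H.
assert (L : is_lim_seq (fun n => Cmod (sum_n (G:=C_AbelianMonoid) u n)) (Cmod l)).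
{ unfold is_lim_seq. eapply filterlim_comp. exact Hu.
  exact (filterlim_norm (K:=C_AbsRing) (V:=C_NormedModule) l). }
refine (is_lim_seq_le _ (sum_n v) (Cmod l) m _ L Hv).
intros n. induction n as [|n IH]; [rewrite !sum_O; apply H|].
rewrite !sum_Sn. eapply Rle_trans; [apply Cmod_triangle|].
unfold plus; simpl. specialize (H (S n)). lra.
Qed.

Lemma cseries_plus (u v : nat -> C) (a b : C) :
  cseries u a -> cseries v b -> cseries (fun n => u n + v n)%C (a + b)%C.
Proof. exact (@is_series_plus C_AbsRing C_NormedModule u v a b). Qed.

Lemma cseries_minus (u v : nat -> C) (a b : C) :
  cseries u a -> cseries v b -> cseries (fun n => u n - v n)%C (a - b)%C.
Proof. exact (@is_series_minus C_AbsRing C_NormedModule u v a b). Qed.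

Lemma cseries_scal (c : C) (u : nat -> C) (a : C) :
  cseries u a -> cseries (fun n => c * u n)%C (c * a)%C.
Proof. exact (@is_series_scal C_AbsRing C_NormedModule c u a). Qed.

Lemma cseries_ext (u v : nat -> C) (a : C) : (forall n, u n = v n) -> cseries u a -> cseries v a.
Proof. exact (@is_series_ext C_AbsRing C_NormedModule u v a). Qed.

Lemma cseries_shift (u : nat -> C) (l : C) :
  cseries (fun n => u (S n)) (l - u 0%nat)%C <-> cseries u l.
Proof.
split.
- intros H. apply (is_series_decr_1 (K:=C_AbsRing) (V:=C_NormedModule)). exact H.
- intros H. apply (is_series_incr_1 (K:=C_AbsRing) (V:=C_NormedModule)).
  refine (eq_rect _ (fun m => cseries u m) H _ _).
  change (l = (l - u 0%nat) + u 0%nat)%C. ring.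
Qed.

Lemma cseries_bounded (u : nat -> C) l : cseries u l -> exists M, forall n, Cmod (u n) <= M.
Proof.
rewrite cseries_Re_Im. intros [H1 H2].
assert (B : forall v : nat -> R, ex_series v -> exists M, forall n, Rabs (v n) <= M).
{ intros v Hv. apply ex_series_lim_0 in Hv.
  destruct (filterlim_bounded (K:=R_AbsRing) (V:=R_NormedModule) v) as [M HM].
  exists 0. exact Hv. exists M. exact HM. }
destruct (B _ (ex_intro _ _ H1)) as [M1 HM1].
destruct (B _ (ex_intro _ _ H2)) as [M2 HM2].
exists (M1 + M2). intros n. eapply Rle_trans; [apply Cmod_le_Rabs|].
specialize (HM1 n). specialize (HM2 n). lra.
Qed.

(** * Power series and the exponential *)

Lemma is_pseries_cseries (a : nat -> C) z l :
  is_pseries (K:=C_AbsRing) (V:=C_NormedModule) a z l <-> cseries (fun n => a n * z ^ n)%C l.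
Proof.
unfold is_pseries.
split; apply cseries_ext; intros n; [exact (Cmult_comm _ _)|exact (Cmult_comm _ _)].
Qed.

Definition power_series (a : nat -> C) (f : C -> C) : Prop :=
  forall z, Cmod z < 1 -> cseries (fun n => a n * z ^ n)%C (f z).

Definition coef_derive (a : nat -> C) (n : nat) : C := (RtoC (INR (S n)) * a (S n))%C.

(** [Series] is total, so this is defined on the whole plane; that the value is the sum of a
    convergent series is recorded separately by [power_series]. *)
Definition power_sum (a : nat -> C) (z : C) : C :=
  (Series (fun n => Re (a n * z ^ n)%C), Series (fun n => Im (a n * z ^ n)%C)).

(** Convergence at s = (1 + r) / 2 bounds |a n| s^n, so the radius of the series of moduli is at
    least s > r. Absolute convergence in the disc follows from this. *)
Lemma power_series_radius a f r :
  power_series a f -> 0 <= r < 1 -> Rbar_lt (Rabs r) (CV_radius (fun n => Cmod (a n))).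
Proof.
intros H Hr. set (s := (1 + r) / 2).
assert (Hs : 0 < s < 1) by (unfold s; lra).
destruct (cseries_bounded _ _ (H (RtoC s) ltac:(rewrite Cmod_R, Rabs_pos_eq; lra))) as [M HM].
apply Rbar_lt_le_trans with s.
{ simpl. rewrite Rabs_pos_eq by lra. unfold s; lra. }
apply (proj1 (CV_radius_bounded (fun n => Cmod (a n)))).
exists M. intros n. rewrite Rabs_pos_eq.
- specialize (HM n). rewrite Cmod_mult, Cmod_pow, Cmod_R, Rabs_pos_eq in HM by lra. exact HM.
- apply Rmult_le_pos. apply Cmod_ge_0. apply pow_le; lra.
Qed.

Lemma ex_series_radius (a : nat -> R) r :
  Rbar_lt (Rabs r) (CV_radius a) -> ex_series (fun n => a n * r ^ n).
Proof.
intros H. apply CV_radius_inside in H.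
apply (ex_series_ext (fun n => scal (pow_n (K:=R_AbsRing) r n) (a n))); [|exact H].
intros n. rewrite pow_n_pow. unfold scal; simpl; unfold mult; simpl. ring.
Qed.

Lemma power_series_of_abs a :
  (forall r, 0 <= r < 1 -> ex_series (fun n => Cmod (a n) * r ^ n)) -> power_series a (power_sum a).
Proof.
intros H z Hz.
destruct (cseries_abs (fun n => a n * z ^ n)%C) as [l Hl].
{ apply (ex_series_ext (fun n => Cmod (a n) * Cmod z ^ n)).
  intros n. now rewrite Cmod_mult, Cmod_pow. apply H. split; [apply Cmod_ge_0|easy]. }
replace (power_sum a z) with l; [exact Hl|].
apply cseries_Re_Im in Hl as [H1 H2].
apply is_series_unique in H1, H2. unfold power_sum. rewrite H1, H2. now destruct l.
Qed.

(** Second-order Taylor remainder of a power. The factor is the coefficient of the second derivative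
    of r^(n+2), so that summing over n produces the twice differentiated majorant series. *)
Lemma pow_diff_bound (n : nat) (x y : C) (r : R) :
  Cmod x <= r -> Cmod y <= r ->
  Cmod (x ^ S (S n) - y ^ S (S n) - (x - y) * (RtoC (INR (S (S n))) * y ^ S n))
  <= INR (S (S n)) * INR (S n) * r ^ n * Cmod (x - y) ^ 2.
Proof.
intros Hx Hy.
assert (Hr : 0 <= r) by (eapply Rle_trans; [apply Cmod_ge_0|exact Hx]).
induction n as [|n IH].
- replace (x ^ 2 - y ^ 2 - (x - y) * (RtoC (INR 2) * y ^ 1))%C with ((x - y) ^ 2)%C
    by (simpl; rewrite RtoC_plus; ring).
  rewrite Cmod_pow. simpl (INR _). assert (H := pow2_ge_0 (Cmod (x - y))). simpl (r ^ 0). lra.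
- replace (x ^ S (S (S n)) - y ^ S (S (S n)) - (x - y) * (RtoC (INR (S (S (S n)))) * y ^ S (S n)))%C
    with (x * (x ^ S (S n) - y ^ S (S n) - (x - y) * (RtoC (INR (S (S n))) * y ^ S n))
          + RtoC (INR (S (S n))) * y ^ S n * (x - y) ^ 2)%C.
  2:{ rewrite (S_INR (S (S n))), RtoC_plus. set (c := RtoC (INR (S (S n)))). simpl Cpow. ring. }
  eapply Rle_trans; [apply Cmod_triangle|].
  rewrite !Cmod_mult, !Cmod_pow, Cmod_R, Rabs_pos_eq by apply pos_INR.
  assert (H2 := pow2_ge_0 (Cmod (x - y))).
  assert (Hn : 0 <= INR n) by apply pos_INR.
  assert (A : Cmod x * Cmod (x ^ S (S n) - y ^ S (S n) - (x - y) * (RtoC (INR (S (S n))) * y ^ S n))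
     <= r * (INR (S (S n)) * INR (S n) * r ^ n * Cmod (x - y) ^ 2)).
  { apply Rmult_le_compat; try apply Cmod_ge_0; assumption. }
  assert (B : INR (S (S n)) * Cmod y ^ S n * Cmod (x - y) ^ 2 <= INR (S (S n)) * r ^ S n * Cmod (x - y) ^ 2).
  { apply Rmult_le_compat_r; [easy|]. apply Rmult_le_compat_l; [apply pos_INR|].
    apply pow_incr. split; [apply Cmod_ge_0|easy]. }
  assert (HR : 0 <= r ^ n) by (apply pow_le; lra).
  assert (0 <= r * r ^ n * Cmod (x - y) ^ 2) by (apply Rmult_le_pos; [apply Rmult_le_pos|]; lra).
  rewrite !S_INR in *. change (r ^ S n) with (r * r ^ n) in *.
  nra.
Qed.

(** The remainder at [z] is at most K |y - z|^2, where K is the sum of the second derivative of the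
    series of moduli at a radius r strictly between |z| and 1. *)
Lemma power_series_derive a f :
  power_series a f ->
  power_series (coef_derive a) (power_sum (coef_derive a)) /\
  forall z, Cmod z < 1 -> cder f z (power_sum (coef_derive a) z).
Proof.
intros H.
set (al := fun n => Cmod (a n)).
assert (R1 : forall r, 0 <= r < 1 -> Rbar_lt (Rabs r) (CV_radius (PS_derive al))).
{ intros r Hr. rewrite CV_radius_derive. now apply (power_series_radius a f). }
assert (R2 : forall r, 0 <= r < 1 -> Rbar_lt (Rabs r) (CV_radius (PS_derive (PS_derive al)))).
{ intros r Hr. rewrite CV_radius_derive. now apply R1. }
assert (P : power_series (coef_derive a) (power_sum (coef_derive a))).
{ apply power_series_of_abs. intros r Hr.
  eapply ex_series_ext; [|apply (ex_series_radius _ _ (R1 r Hr))].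
  intros n. unfold PS_derive, coef_derive, al.
  rewrite Cmod_mult, Cmod_R, Rabs_pos_eq by apply pos_INR. reflexivity. }
split; [exact P|]. intros z Hz.
set (r := (1 + Cmod z) / 2).
assert (Hz0 := Cmod_ge_0 z).
assert (Hr : 0 <= r < 1) by (unfold r; lra).
destruct (ex_series_radius _ _ (R2 r Hr)) as [K HK].
assert (Q : forall y, Cmod (y - z) < r - Cmod z ->
   Cmod (f y - f z - (y - z) * power_sum (coef_derive a) z) <= K * Cmod (y - z) ^ 2).
{ intros y Hy.
  assert (Hyr : Cmod y <= r).
  { replace y with (z + (y - z))%C by ring. eapply Rle_trans; [apply Cmod_triangle|]. lra. }
  assert (S1 := cseries_minus _ _ _ _ (H y ltac:(lra)) (H z Hz)).
  apply cseries_shift in S1.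
  assert (S2 := cseries_minus _ _ _ _ S1 (cseries_scal (y - z) _ _ (P z Hz))).
  apply cseries_shift in S2.
  (* Both terms removed by the shifts are zero: the constant terms cancel, and the linear term
     cancels against the first term of the derived series. *)
  replace (f y - f z - (y - z) * power_sum (coef_derive a) z)%C with
   (f y - f z - (a 0%nat * y ^ 0 - a 0%nat * z ^ 0) - (y - z) * power_sum (coef_derive a) z -
       (a 1%nat * y ^ 1 - a 1%nat * z ^ 1 - (y - z) * (coef_derive a 0 * z ^ 0)))%C
    by (unfold coef_derive; simpl; ring).
  assert (HK' := is_series_scal (K:=R_AbsRing) (V:=R_NormedModule) (Cmod (y - z) ^ 2) _ _ HK).
  rewrite Rmult_comm.
  refine (cseries_norm_le _ _ _ _ S2 HK' _). intros n. cbv beta.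
  unfold scal; simpl; unfold mult; simpl.
  change (Cmod (a (S (S n)) * y ^ S (S n) - a (S (S n)) * z ^ S (S n) -
       (y - z) * (coef_derive a (S n) * z ^ S n)) <=
     Cmod (y - z) ^ 2 * (PS_derive (PS_derive al) n * r ^ n)).
  unfold PS_derive, coef_derive, al.
  replace (a (S (S n)) * y ^ S (S n) - a (S (S n)) * z ^ S (S n) -
     (y - z) * (RtoC (INR (S (S n))) * a (S (S n)) * z ^ S n))%C with
   (a (S (S n)) * (y ^ S (S n) - z ^ S (S n) - (y - z) * (RtoC (INR (S (S n))) * z ^ S n)))%C by ring.
  rewrite Cmod_mult.
  eapply Rle_trans; [apply Rmult_le_compat_l; [apply Cmod_ge_0|]|].
  apply (pow_diff_bound n y z r Hyr). unfold r; lra.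
  apply Req_le. ring. }
apply cder_eps. intros eps He.
exists (Rmin (r - Cmod z) (eps / (1 + Rabs K))).
assert (HKp := Rabs_pos K).
split. { apply Rmin_pos; [unfold r; lra|apply Rdiv_lt_0_compat; lra]. }
intros y Hy.
eapply Rle_trans; [apply Q; eapply Rlt_le_trans; [exact Hy|apply Rmin_l]|].
assert (H3 : Cmod (y - z) < eps / (1 + Rabs K)) by (eapply Rlt_le_trans; [exact Hy|apply Rmin_r]).
apply (Rmult_lt_compat_l (1 + Rabs K)) in H3; [|lra].
replace ((1 + Rabs K) * (eps / (1 + Rabs K))) with eps in H3 by (field; lra).
assert (H4 := Cmod_ge_0 (y - z)). assert (H5 := Rle_abs K). simpl. nra.
Qed.

Lemma power_series_0 a f : power_series a f -> f (RtoC 0) = a 0%nat.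
Proof.
intros H. assert (H0 := H (RtoC 0) ltac:(rewrite Cmod_0; lra)).
apply cseries_shift in H0.
(* At the origin the tail has only zero terms, so multiplication by 0 leaves it unchanged and its
   sum equals 0 times itself. *)
assert (Z := cseries_scal (RtoC 0) _ _ H0).
apply cseries_ext with (v := fun n => (a (S n) * RtoC 0 ^ S n)%C) in Z; [|intros n; simpl; ring].
assert (E := cseries_unique _ _ _ H0 Z). simpl in E.
replace (f (RtoC 0)) with ((f (RtoC 0) - a 0%nat * 1) + a 0%nat)%C by ring. rewrite E. ring.
Qed.

(** * The exponential, the sine and the cosine *)

Definition Cexp (z : C) : C := (exp (Re z) * cos (Im z), exp (Re z) * sin (Im z)).

Lemma Cexp_plus z w : Cexp (z + w) = (Cexp z * Cexp w)%C.
Proof.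
destruct z as [a b], w as [c d]. unfold Cexp, Cplus, Cmult, Re, Im; simpl.
rewrite exp_plus, cos_plus, sin_plus. f_equal; ring.
Qed.

Lemma Cexp_0 : Cexp (RtoC 0) = RtoC 1.
Proof. unfold Cexp, RtoC, Re, Im; simpl. rewrite exp_0, cos_0, sin_0. f_equal; ring. Qed.

Lemma Cmod_Cexp z : Cmod (Cexp z) = exp (Re z).
Proof.
assert (H : Cmod (Cexp z) ^ 2 = exp (Re z) ^ 2).
{ rewrite Cmod2_alt. unfold Cexp. simpl. assert (H := sin2_cos2 (Im z)). unfold Rsqr in H. nra. }
assert (H1 := Cmod_ge_0 (Cexp z)). assert (H2 := exp_pos (Re z)). nra.
Qed.

Lemma Cexp_opp z : (Cexp z * Cexp (- z))%C = RtoC 1.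
Proof. rewrite <- Cexp_plus. replace (z + - z)%C with (RtoC 0) by ring. apply Cexp_0. Qed.

Lemma cder_Cexp_0 : cder Cexp (RtoC 0) (RtoC 1).
Proof.
apply cder_eps. intros eps He.
(* The real and imaginary errors turn out to be at most 4 e |y| and 5 e |y|, which fits under 10 e;
   the cap 1 keeps |exp x| <= 3. *)
set (e := Rmin 1 (eps / 10)).
assert (He' : 0 < e) by (apply Rmin_pos; lra).
assert (e <= 1) by apply Rmin_l. assert (e <= eps / 10) by apply Rmin_r.
assert (D1 := proj1 (is_derive_Reals _ _ _) (eq_ind _ (fun l => is_derive exp 0 l) (proj2 (is_derive_Reals _ _ _) (derivable_pt_lim_exp 0)) 1 exp_0)).
assert (D2 := derivable_pt_lim_cos 0). assert (D3 := derivable_pt_lim_sin 0).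
apply is_derive_Reals in D1, D2, D3. rewrite sin_0 in D2. rewrite cos_0 in D3.
rewrite rder_eps in D1, D2, D3.
destruct (D1 e He') as [d1 [Hd1 H1]]. destruct (D2 e He') as [d2 [Hd2 H2]].
destruct (D3 e He') as [d3 [Hd3 H3]].
exists (Rmin (Rmin d1 d2) (Rmin d3 e)).
split; [apply Rmin_pos; apply Rmin_pos; assumption|]. intros y Hy.
replace (y - RtoC 0)%C with y in * by ring.
assert (M1 := Rmin_l (Rmin d1 d2) (Rmin d3 e)). assert (M2 := Rmin_r (Rmin d1 d2) (Rmin d3 e)).
assert (M3 := Rmin_l d1 d2). assert (M4 := Rmin_r d1 d2).
assert (M5 := Rmin_l d3 e). assert (M6 := Rmin_r d3 e).
assert (A := re_le_Cmod y). assert (B := Rabs_snd_le_Cmod y).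
destruct y as [x v]. set (m := Cmod (x, v)) in *. unfold Re, Im in A, B; simpl in A, B.
specialize (H1 x ltac:(rewrite Rminus_0_r; lra)).
specialize (H2 v ltac:(rewrite Rminus_0_r; lra)).
specialize (H3 v ltac:(rewrite Rminus_0_r; lra)).
rewrite exp_0 in H1. rewrite cos_0 in H2. rewrite sin_0 in H3.
rewrite Rminus_0_r, Rmult_1_r in H1.
rewrite Ropp_0, Rmult_0_r, !Rminus_0_r in H2.
rewrite !Rminus_0_r, Rmult_1_r in H3.
rewrite Cexp_0. eapply Rle_trans; [apply Cmod_le_Rabs|].
unfold Cexp, RtoC, Cminus, Cplus, Copp, Cmult, Re, Im; simpl.
set (X := exp x) in *.
assert (H1' : Rabs (X - 1 - x) <= e * m) by (eapply Rle_trans; [exact H1|]; nra).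
assert (H2' : Rabs (cos v - 1) <= e * m) by (eapply Rle_trans; [exact H2|]; nra).
assert (H3' : Rabs (sin v - v) <= e * m) by (eapply Rle_trans; [exact H3|]; nra).
assert (Hm : 0 <= m) by apply Cmod_ge_0.
assert (Hm1 : m <= e) by lra.
assert (HX : Rabs (X - 1) <= 2 * m).
{ replace (X - 1) with ((X - 1 - x) + x) by ring. eapply Rle_trans; [apply Rabs_triang|]. nra. }
assert (HX3 : Rabs X <= 3).
{ replace X with ((X - 1) + 1) by ring. eapply Rle_trans; [apply Rabs_triang|]. rewrite Rabs_R1. lra. }
assert (T1 : Rabs (X * cos v + - (1) + - (x * 1 - v * 0)) <= 4 * e * m).
{ replace (X * cos v + - (1) + - (x * 1 - v * 0)) with ((X - 1 - x) + X * (cos v - 1)) by ring.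
  eapply Rle_trans; [apply Rabs_triang|]. rewrite Rabs_mult.
  assert (Rabs X * Rabs (cos v - 1) <= 3 * (e * m)) by (apply Rmult_le_compat; auto using Rabs_pos). lra. }
assert (T2 : Rabs (X * sin v + - 0 + - (x * 0 + v * 1)) <= 5 * e * m).
{ replace (X * sin v + - 0 + - (x * 0 + v * 1)) with (X * (sin v - v) + (X - 1) * v) by ring.
  eapply Rle_trans; [apply Rabs_triang|]. rewrite !Rabs_mult.
  assert (Rabs X * Rabs (sin v - v) <= 3 * (e * m)) by (apply Rmult_le_compat; auto using Rabs_pos).
  assert (Rabs (X - 1) * Rabs v <= 2 * m * e) by (apply Rmult_le_compat; auto using Rabs_pos; lra). lra. }
replace (x + -0) with x in * by ring. replace (v + -0) with v in * by ring.
nra.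
Qed.

Lemma cder_Cexp z : cder Cexp z (Cexp z).
Proof.
apply (is_derive_ext (K:=C_AbsRing) (V:=C_NormedModule) (fun y => Cexp z * Cexp (y - z))%C).
{ intros t. rewrite <- Cexp_plus. f_equal. change ((z + (t - z)) = t :> C)%C. ring. }
eapply cder_eq.
- apply cder_scal. apply (cder_comp Cexp (fun y => y - z)%C).
  replace (z - z)%C with (RtoC 0) by ring. apply cder_Cexp_0.
  apply (cder_minus (fun y => y) (fun _ => z)). apply cder_id. apply cder_const.
- ring.
Qed.

Definition Csin (z : C) : C := ((Cexp (Ci * z) - Cexp (- (Ci * z))) / (2 * Ci))%C.
Definition Ccos (z : C) : C := ((Cexp (Ci * z) + Cexp (- (Ci * z))) / 2)%C.

Lemma Ci2 : (Ci * Ci = - (1))%C.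
Proof. unfold Ci, RtoC, Copp, Cmult; simpl. f_equal; ring. Qed.

Lemma Ci_neq_0 : Ci <> RtoC 0.
Proof. intros H. apply (f_equal Im) in H. unfold Ci, RtoC, Im in H; simpl in H. lra. Qed.

Lemma C2_neq_0 : RtoC 2 <> RtoC 0.
Proof. intros H. apply RtoC_inj in H. lra. Qed.

Lemma cder_Csin z : cder Csin z (Ccos z).
Proof.
unfold Csin, Ccos.
assert (H := Ci_neq_0). assert (H2 := C2_neq_0).
assert (D : forall y : C, cder (fun z => Ci * z)%C y Ci).
{ intros y. eapply cder_eq. apply cder_scal. apply cder_id. ring. }
eapply cder_eq. apply cder_div.
- apply cder_minus. apply (cder_comp Cexp). apply cder_Cexp. apply D.
  apply (cder_comp Cexp). apply cder_Cexp. apply cder_opp. apply D.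
- apply cder_const.
- apply Cmult_neq_0; auto.
- cbv beta. field. auto.
Qed.

Lemma cder_Ccos z : cder Ccos z (- Csin z)%C.
Proof.
unfold Csin, Ccos.
assert (H := Ci_neq_0). assert (H2 := C2_neq_0).
assert (D : forall y : C, cder (fun z => Ci * z)%C y Ci).
{ intros y. eapply cder_eq. apply cder_scal. apply cder_id. ring. }
eapply cder_eq. apply cder_div.
- apply cder_plus. apply (cder_comp Cexp). apply cder_Cexp. apply D.
  apply (cder_comp Cexp). apply cder_Cexp. apply cder_opp. apply D.
- apply cder_const.
- auto.
- cbv beta. match goal with |- ?a = ?b => replace b with (- ((Cexp (Ci * z) - Cexp (- (Ci * z))) * Ci) / (2 * (Ci * Ci)))%C by (field; auto) end. rewrite Ci2. field.
Qed.

(** * The principal branches *)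

Lemma C_eq (z w : C) : Re z = Re w -> Im z = Im w -> z = w.
Proof. destruct z, w. unfold Re, Im; simpl. congruence. Qed.

Lemma Cmod_Re_bounds (z : C) : - Cmod z <= Re z <= Cmod z.
Proof. assert (H := re_le_Cmod z). apply Rabs_le_between in H. exact H. Qed.

(** Half-angle formulas: the two real roots have product |Im z| / 2, because (m + Re z) (m - Re z) =
    (Im z)^2 for m = |z|, and the sign rule restores the sign of [Im z]. *)
Lemma Csqrt_mult_self (z : C) : (Csqrt z * Csqrt z)%C = z.
Proof.
assert (B := Cmod_Re_bounds z). assert (E := Cmod2_alt z).
set (m := Cmod z) in *.
assert (P1 : 0 <= (m + Re z) / 2) by lra. assert (P2 : 0 <= (m - Re z) / 2) by lra.
assert (S1 := sqrt_sqrt _ P1). assert (S2 := sqrt_sqrt _ P2).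
assert (S3 : sqrt ((m + Re z) / 2) * sqrt ((m - Re z) / 2) = Rabs (Im z) / 2).
{ rewrite <- sqrt_mult by assumption.
  replace ((m + Re z) / 2 * ((m - Re z) / 2)) with (Rsqr (Im z / 2)) by (unfold Rsqr; nra).
  rewrite sqrt_Rsqr_abs. unfold Rdiv. rewrite Rabs_mult, (Rabs_pos_eq (/ 2)) by lra. reflexivity. }
unfold Csqrt. fold m. apply C_eq.
- unfold Cmult, Re, Im in *; simpl. destruct (Rle_dec 0 (snd z)); nra.
- unfold Cmult, Re, Im in *; simpl. destruct (Rle_dec 0 (snd z)) as [H|H].
  + rewrite Rabs_pos_eq in S3 by lra. lra.
  + rewrite Rabs_left in S3 by lra. lra.
Qed.

Lemma Csqrt_square (s : C) : 0 < Re s -> Csqrt (s * s) = s.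
Proof.
intros H. assert (M : Cmod (s * s) = Re s ^ 2 + Im s ^ 2).
{ rewrite Cmod_mult. rewrite <- Cmod2_alt. ring. }
unfold Csqrt. rewrite M.
destruct s as [p q]. unfold Cmult, Re, Im in *; simpl in *.
replace ((p * (p * 1) + q * (q * 1) + (p * p - q * q)) / 2) with (Rsqr p) by (unfold Rsqr; field).
replace ((p * (p * 1) + q * (q * 1) - (p * p - q * q)) / 2) with (Rsqr q) by (unfold Rsqr; field).
rewrite !sqrt_Rsqr_abs, (Rabs_pos_eq p) by lra. f_equal.
destruct (Rle_dec 0 (p * q + q * p)) as [G|G].
- apply Rabs_pos_eq. nra.
- rewrite Rabs_left by nra. ring.
Qed.

Lemma Cexp_Clog (z : C) : z <> RtoC 0 -> Cexp (Clog z) = z.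
Proof.
intros H. assert (Hm : 0 < Cmod z) by now apply Cmod_gt_0.
assert (B := Cmod_Re_bounds z). assert (E := Cmod2_alt z).
set (m := Cmod z) in *.
assert (X : -1 <= Re z / m <= 1).
{ split; apply (Rmult_le_reg_r m); try lra; unfold Rdiv; rewrite Rmult_assoc, Rinv_l; lra. }
assert (S : m * sqrt (1 - Rsqr (Re z / m)) = Rabs (Im z)).
{ rewrite <- (sqrt_Rsqr m) at 1 by lra. rewrite <- sqrt_mult.
  - rewrite <- sqrt_Rsqr_abs. f_equal. unfold Rsqr. field_simplify; [|lra]. unfold Rdiv. nra.
  - apply Rle_0_sqr.
  - unfold Rsqr. nra. }
unfold Cexp, Clog, Carg. fold m. change (Re (ln m, if Rle_dec 0 (Im z) then acos (Re z / m) else - acos (Re z / m))) with (ln m).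
change (Im (ln m, if Rle_dec 0 (Im z) then acos (Re z / m) else - acos (Re z / m))) with (if Rle_dec 0 (Im z) then acos (Re z / m) else - acos (Re z / m)).
rewrite exp_ln by lra.
destruct (Rle_dec 0 (Im z)) as [G|G]; apply C_eq; unfold Re at 1 || unfold Im at 1; simpl.
- rewrite cos_acos by lra. field. lra.
- rewrite sin_acos by lra. rewrite S. apply Rabs_pos_eq. exact G.
- rewrite cos_neg, cos_acos by lra. field. lra.
- rewrite sin_neg, sin_acos by lra. rewrite Ropp_mult_distr_r_reverse, S, Rabs_left by lra. ring.
Qed.

Lemma Clog_Cexp (u : C) : - PI < Im u < PI -> Clog (Cexp u) = u.
Proof.
intros H. unfold Clog, Carg. rewrite Cmod_Cexp, ln_exp.
assert (P := exp_pos (Re u)).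
replace (Re (Cexp u) / exp (Re u)) with (cos (Im u))
  by (unfold Cexp; simpl; field; lra).
assert (E : Im (Cexp u) = exp (Re u) * sin (Im u)) by reflexivity. rewrite E.
apply C_eq; [reflexivity|]. unfold Im at 1; simpl.
destruct (Rle_lt_dec 0 (Im u)) as [G|G].
- assert (0 <= sin (Im u)) by (apply sin_ge_0; lra).
  destruct (Rle_dec 0 (exp (Re u) * sin (Im u))) as [K|K]; [|exfalso; apply K; nra].
  apply acos_cos; lra.
- assert (sin (Im u) < 0) by (apply sin_lt_0_var; lra).
  destruct (Rle_dec 0 (exp (Re u) * sin (Im u))) as [K|K]; [nra|].
  rewrite <- cos_neg, acos_cos by lra. ring.
Qed.

(** The argument of the logarithm in [Carcsin] has an explicit inverse for every [w]. It is
    therefore never 0, and any upper bound for the inverse is a lower bound for the argument. *)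
Lemma Carcsin_log_arg (w : C) :
  ((Ci * w + Csqrt (RtoC 1 - w * w)) * (- (Ci * w) + Csqrt (RtoC 1 - w * w)))%C = RtoC 1.
Proof.
set (s := Csqrt (RtoC 1 - w * w)).
replace ((Ci * w + s) * (- (Ci * w) + s))%C with (s * s - (Ci * Ci) * (w * w))%C by ring.
unfold s. rewrite Csqrt_mult_self, Ci2. ring.
Qed.

Lemma Carcsin_log_arg_neq_0 (w : C) : (Ci * w + Csqrt (RtoC 1 - w * w))%C <> RtoC 0.
Proof.
intros H. assert (E := Carcsin_log_arg w). rewrite H in E.
rewrite Cmult_0_l in E. apply RtoC_inj in E. lra.
Qed.

(** Only [Cexp (Clog k) = k] enters, so the identity holds on the whole plane whatever the branch;
    this recovers the Schwarz function from its arcsine. *)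
Lemma Csin_Carcsin (w : C) : Csin (Carcsin w) = w.
Proof.
assert (N := Carcsin_log_arg_neq_0 w). assert (E := Carcsin_log_arg w).
unfold Csin, Carcsin. set (s := Csqrt (RtoC 1 - w * w)) in *. set (k := (Ci * w + s)%C) in *.
replace (Ci * (- Ci * Clog k))%C with (- (Ci * Ci) * Clog k)%C by ring.
rewrite Ci2. replace (- - (1) * Clog k)%C with (Clog k) by ring.
assert (E1 := Cexp_Clog k N). assert (E2 := Cexp_opp (Clog k)). rewrite E1 in E2.
assert (E3 : Cexp (- Clog k) = (- (Ci * w) + s)%C).
{ transitivity (Cexp (- Clog k) * (k * (- (Ci * w) + s)))%C; [rewrite E; ring|].
  rewrite Cmult_assoc, (Cmult_comm (Cexp _)), E2. ring. }
rewrite E1, E3. unfold k. field. apply Ci_neq_0.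
Qed.

(** In the strip Re (cos u) > 0, so the principal root of 1 - sin^2 u = cos^2 u is cos u. The
    logarithm is then taken of exp (i u), whose exponent has imaginary part [Re u] within the
    principal range. *)
Lemma Carcsin_Csin (u : C) : - (PI / 2) < Re u < PI / 2 -> Carcsin (Csin u) = u.
Proof.
intros H. assert (Hi := Ci_neq_0). assert (H2 := C2_neq_0).
assert (E : (RtoC 1 - Csin u * Csin u)%C = (Ccos u * Ccos u)%C).
{ unfold Csin, Ccos. set (a := Cexp (Ci * u)). set (b := Cexp (- (Ci * u))).
  assert (ab : (a * b)%C = RtoC 1) by apply Cexp_opp.
  replace ((a - b) / (2 * Ci) * ((a - b) / (2 * Ci)))%C
    with ((a * a - 2 * (a * b) + b * b) / (4 * (Ci * Ci)))%C by (field; auto).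
  replace ((a + b) / 2 * ((a + b) / 2))%C
    with ((a * a + 2 * (a * b) + b * b) / 4)%C by (field; auto).
  rewrite ab, Ci2. field. }
assert (Iu : forall v : C, Re (Ci * v) = - Im v /\ Im (Ci * v) = Re v).
{ intros v. unfold Ci, Cmult, Re, Im; simpl. split; ring. }
assert (P : 0 < Re (Ccos u)).
{ assert (C0 : 0 < cos (Re u)) by (apply cos_gt_0; lra).
  assert (E1 := exp_pos (- Im u)). assert (E2 := exp_pos (- - Im u)).
  unfold Ccos.
  replace (Re ((Cexp (Ci * u) + Cexp (- (Ci * u))) / 2)%C)
    with ((exp (- Im u) * cos (Re u) + exp (- - Im u) * cos (- Re u)) / 2).
  - rewrite cos_neg. assert (0 < exp (- Im u) * cos (Re u)) by nra.
    assert (0 < exp (- - Im u) * cos (Re u)) by nra. lra.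
  - unfold Cdiv. rewrite <- RtoC_inv by lra. destruct (Iu u) as [I1 I2].
    rewrite <- I1, <- I2. unfold Cexp, Cplus, Cmult, Copp, RtoC, Re, Im; simpl. field. }
unfold Carcsin. rewrite E, Csqrt_square by exact P.
replace (Ci * Csin u + Ccos u)%C with (Cexp (Ci * u)) by (unfold Csin, Ccos; field; auto).
rewrite Clog_Cexp by (rewrite (proj2 (Iu u)); lra).
replace (- Ci * (Ci * u))%C with (- (Ci * Ci) * u)%C by ring. rewrite Ci2. ring.
Qed.

(** The argument k of the logarithm and its inverse both have modulus at most 3, so |ln |k|| <= ln
    3, and the principal argument is at most PI in absolute value. *)
Lemma Carcsin_bounded : exists M, forall w, Cmod w <= 1 -> Cmod (Carcsin w) <= M.
Proof.
exists (ln 3 + PI). intros w Hw.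
assert (N := Carcsin_log_arg_neq_0 w). assert (E := Carcsin_log_arg w).
assert (S : Cmod (Csqrt (RtoC 1 - w * w)) <= 2).
{ assert (Q := f_equal Cmod (Csqrt_mult_self (RtoC 1 - w * w))). rewrite Cmod_mult in Q.
  assert (Cmod (RtoC 1 - w * w) <= 1 + 1 * 1).
  { eapply Rle_trans; [apply Cmod_triangle|]. rewrite Cmod_opp, Cmod_mult, Cmod_R, Rabs_R1.
    assert (G := Cmod_ge_0 w). nra. }
  assert (G := Cmod_ge_0 (Csqrt (RtoC 1 - w * w))). nra. }
unfold Carcsin. set (s := Csqrt (RtoC 1 - w * w)) in *. set (k := (Ci * w + s)%C) in *.
assert (K1 : Cmod k <= 3).
{ unfold k. eapply Rle_trans; [apply Cmod_triangle|]. rewrite Cmod_mult, Cmod_Ci. lra. }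
assert (K2 : Cmod (- (Ci * w) + s) <= 3).
{ eapply Rle_trans; [apply Cmod_triangle|]. rewrite Cmod_opp, Cmod_mult, Cmod_Ci. lra. }
apply (f_equal Cmod) in E. rewrite Cmod_mult, Cmod_1 in E.
assert (K0 : 0 < Cmod k) by now apply Cmod_gt_0.
rewrite Cmod_mult, Cmod_opp, Cmod_Ci, Rmult_1_l.
eapply Rle_trans; [apply Cmod_le_Rabs|]. unfold Clog, Re, Im; simpl.
apply Rplus_le_compat.
- apply Rabs_le. split.
  + rewrite <- ln_Rinv by lra. apply ln_le; [lra|].
    apply (Rmult_le_reg_l 3); [lra|]. rewrite Rinv_r by lra. nra.
  + apply ln_le; lra.
- unfold Carg. assert (A := acos_bound (Re k / Cmod k)).
  destruct (Rle_dec 0 (Im k)); rewrite ?Rabs_Ropp, Rabs_pos_eq; lra.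
Qed.

(** * Means over circles *)

Definition cis (t : R) : C := (cos t, sin t).

Lemma Cmod_cis t : Cmod (cis t) = 1.
Proof.
assert (H : Cmod (cis t) ^ 2 = 1).
{ rewrite Cmod2_alt. unfold cis, Re, Im; simpl. assert (H := sin2_cos2 t). unfold Rsqr in H. lra. }
assert (G := Cmod_ge_0 (cis t)). nra.
Qed.

Lemma curve_der_cis t : curve_der cis t (Ci * cis t)%C.
Proof.
replace (Ci * cis t)%C with ((- sin t, cos t) : C)
  by (unfold Ci, cis, Cmult; simpl; f_equal; ring).
apply curve_der_pair; apply is_derive_Reals.
apply derivable_pt_lim_cos. apply derivable_pt_lim_sin.
Qed.

Lemma cis_continuous t : forall eps, 0 < eps -> exists d, 0 < d /\
  forall s, Rabs (s - t) < d -> Cmod (cis s - cis t) < eps.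
Proof.
intros eps He. destruct (curve_der_cis t 1 Rlt_0_1) as [d [Hd H]].
exists (Rmin d (eps / 2)). split; [apply Rmin_pos; lra|]. intros s Hs.
specialize (H s (Rlt_le_trans _ _ _ Hs (Rmin_l _ _))).
assert (H2 := Rlt_le_trans _ _ _ Hs (Rmin_r _ _)).
replace (cis s - cis t)%C with ((cis s - cis t - RtoC (s - t) * (Ci * cis t)) + RtoC (s - t) * (Ci * cis t))%C by ring.
eapply Rle_lt_trans; [apply Cmod_triangle|].
rewrite !Cmod_mult, Cmod_Ci, Cmod_cis, Cmod_R. lra.
Qed.

Lemma Cmod_circle r t : 0 <= r -> Cmod (RtoC r * cis t) = r.
Proof. intros H. rewrite Cmod_mult, Cmod_cis, Cmod_R, Rabs_pos_eq; lra. Qed.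

Lemma curve_der_circle r t : curve_der (fun s => RtoC r * cis s)%C t (Ci * (RtoC r * cis t))%C.
Proof.
replace (Ci * (RtoC r * cis t))%C with ((Ci * cis t) * RtoC r)%C by ring.
apply (curve_der_comp (fun y => RtoC r * y)%C cis).
- eapply cder_eq. apply cder_scal. apply cder_id. ring.
- apply curve_der_cis.
Qed.

Lemma curve_der_ray r t : curve_der (fun s => RtoC s * cis t)%C r (cis t).
Proof.
intros eps He. destruct (curve_der_segment (RtoC 0) (cis t) r eps He) as [d [Hd H]].
exists d; split; [easy|]. intros s Hs. specialize (H s Hs). cbv beta in H.
rewrite !Cplus_0_l in H. exact H.
Qed.

Notation circle_pt r t := (RtoC r * cis t)%C.

(** The second condition supplies continuity of [G'], which integrability on circles and
    differentiation under the integral sign rely on. *)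
Definition derivative_differentiable (D : C -> Prop) (G G' : C -> C) : Prop :=
  forall z, D z -> cder G z (G' z) /\ exists l, cder G' z l.

Definition punctured_disc (z : C) : Prop := 0 < Cmod z < 1.

(** The radial derivative of the mean is the integral of Re (e^(it) G'), and r times this integrand
    is the t-derivative of Re (-i G), a function of period 2 PI on the circle. So the radial
    derivative vanishes. *)
Lemma circle_mean_const (G G' : C -> C) :
  derivative_differentiable punctured_disc G G' ->
  exists v, forall r, 0 < r < 1 -> is_RInt (fun t => Re (G (circle_pt r t))) 0 (2 * PI) v.
Proof.
intros H.
assert (Dom : forall r t, 0 < r < 1 -> punctured_disc (circle_pt r t)).
{ intros r t Hr. unfold punctured_disc. rewrite Cmod_circle; lra. }
assert (Dr : forall r t, 0 < r < 1 ->
  is_derive (fun s => Re (G (circle_pt s t))) r (Re (cis t * G' (circle_pt r t)))).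
{ intros r t Hr. apply curve_der_Re. apply curve_der_comp.
  apply (H _ (Dom r t Hr)). apply curve_der_ray. }
assert (Dt : forall k r t, 0 < r < 1 ->
  is_derive (fun s => Re (k * G (circle_pt r s))) t (Re (k * (Ci * (circle_pt r t) * G' (circle_pt r t))))).
{ intros k r t Hr.
  replace (k * (Ci * (circle_pt r t) * G' (circle_pt r t)))%C
    with (Ci * (circle_pt r t) * (k * G' (circle_pt r t)))%C by ring.
  apply curve_der_Re. apply (curve_der_comp (fun y => k * G y)%C (fun s => circle_pt r s)%C).
  apply cder_scal. apply (H _ (Dom r t Hr)). apply curve_der_circle. }
assert (I : forall r, 0 < r < 1 -> ex_RInt (fun t => Re (G (circle_pt r t))) 0 (2 * PI)).
{ intros r Hr. apply (ex_RInt_continuous (V:=R_CompleteNormedModule)). intros t _.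
  apply (ex_derive_continuous (K:=R_AbsRing) (V:=R_NormedModule)).
  eexists. apply (is_derive_ext (fun s => Re (RtoC 1 * G (circle_pt r s))%C)).
  intros s. now rewrite Cmult_1_l. apply Dt. exact Hr. }
set (F := fun r => RInt (fun t => Re (G (circle_pt r t))) 0 (2 * PI)).
assert (Z : forall r, 0 < r < 1 -> is_RInt (fun t => Re (cis t * G' (circle_pt r t))) 0 (2 * PI) 0).
{ intros r Hr.
  set (h := fun t => Re (- Ci * G (circle_pt r t))%C).
  assert (Dh : forall t, is_derive h t (r * Re (cis t * G' (circle_pt r t)))).
  { intros t. assert (E := Dt (- Ci)%C r t Hr). fold h in E.
    replace (r * Re (cis t * G' (circle_pt r t))) with
      (Re (- Ci * (Ci * (circle_pt r t) * G' (circle_pt r t)))); [exact E|].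
    replace (- Ci * (Ci * (circle_pt r t) * G' (circle_pt r t)))%C
      with (- (Ci * Ci) * RtoC r * (cis t * G' (circle_pt r t)))%C by ring.
    rewrite Ci2. unfold RtoC, Copp, Cmult, Re, Im; simpl. ring. }
  assert (J : is_RInt (fun t => r * Re (cis t * G' (circle_pt r t))) 0 (2 * PI) (minus (h (2 * PI)) (h 0))).
  { apply (is_RInt_derive h). intros t _. apply Dh.
    intros t _. apply (continuous_scal_r (K:=R_AbsRing) (V:=R_NormedModule) r).
    apply (ex_derive_continuous (K:=R_AbsRing) (V:=R_NormedModule)).
    destruct (H _ (Dom r t Hr)) as [_ [l Hl]].
    set (P := fun z => (z * G' z)%C).
    eexists. apply (is_derive_ext (fun s => Re (RtoC (/ r) * P (circle_pt r s)))%C).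
    { intros s. unfold P. f_equal. rewrite !Cmult_assoc, <- RtoC_mult, Rinv_l by lra. now rewrite Cmult_1_l. }
    apply curve_der_Re. apply (curve_der_comp (fun z => RtoC (/ r) * P z)%C (fun s => circle_pt r s)%C).
    apply cder_scal. apply cder_mult. apply cder_id. exact Hl. apply curve_der_circle. }
  assert (E0 : minus (h (2 * PI)) (h 0) = 0).
  { unfold h, cis. rewrite cos_2PI, sin_2PI, cos_0, sin_0. apply Rminus_diag_eq. reflexivity. }
  rewrite E0 in J.
  apply (is_RInt_scal _ _ _ (/ r)) in J.
  replace 0 with (scal (/ r) 0) at 2 by (unfold scal; simpl; unfold mult; simpl; ring).
  eapply is_RInt_ext; [|exact J].
  intros t _. unfold scal; simpl; unfold mult; simpl. field. lra. }
assert (DF : forall r, 0 < r < 1 -> is_derive F r 0).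
{ intros r Hr.
  assert (Hnb : locally r (fun u => 0 < u < 1)).
  { assert (0 < Rmin r (1 - r)) by (apply Rmin_pos; lra).
    exists (mkposreal _ H0). intros u Hu. unfold ball in Hu; simpl in Hu. unfold AbsRing_ball, abs, minus, plus, opp in Hu; simpl in Hu.
    apply Rabs_def2 in Hu. assert (A := Rmin_l r (1 - r)). assert (B := Rmin_r r (1 - r)). lra. }
  assert (DE : forall u t, 0 < u < 1 ->
     Derive (fun z => Re (G (circle_pt z t))) u = Re (cis t * G' (circle_pt u t))).
  { intros u t Hu. apply is_derive_unique. apply Dr. exact Hu. }
  assert (E : RInt (fun t => Derive (fun u => Re (G (circle_pt u t))) r) 0 (2 * PI) = 0).
  { apply is_RInt_unique. eapply is_RInt_ext; [|apply (Z r Hr)].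
    intros t _. symmetry. apply DE. exact Hr. }
  rewrite <- E. unfold F. apply (is_derive_RInt_param (fun r t => Re (G (circle_pt r t)))).
  - eapply filter_imp; [|exact Hnb]. intros u Hu t _. eexists. apply Dr. exact Hu.
  - intros t _.
    apply continuity_2d_pt_ext_loc with (fun u v => Re (cis v * G' (circle_pt u v))).
    { assert (0 < Rmin r (1 - r)) by (apply Rmin_pos; lra).
      exists (mkposreal _ H0). intros u v Hu _. simpl in Hu. symmetry. apply DE.
      apply Rabs_def2 in Hu. assert (A := Rmin_l r (1 - r)). assert (B := Rmin_r r (1 - r)). lra. }
    intros eps.
    destruct (H _ (Dom r t Hr)) as [_ [l Hl]].
    set (q := (circle_pt r t)) in *.
    destruct (cder_continuous G' q l Hl (eps / 2)) as [d1 [Hd1 K1]]; [apply is_pos_div_2|].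
    assert (Hm := Cmod_ge_0 (G' q)). assert (Hep := cond_pos eps).
    (* Moving (r, t) to (u, v) displaces the point by less than d1 / 2 radially and d1 / 2 along the
       circle; the second bound handles the change of the factor [cis] in front of [G' q]. *)
    set (e2 := Rmin (d1 / 2) (eps / (2 * (1 + Cmod (G' q))))).
    assert (He2 : 0 < e2) by (apply Rmin_pos; [lra|apply Rdiv_lt_0_compat; lra]).
    destruct (cis_continuous t e2 He2) as [d2 [Hd2 K2]].
    assert (Hd : 0 < Rmin (d1 / 2) d2) by (apply Rmin_pos; lra).
    exists (mkposreal _ Hd). intros u v Hu Hv. simpl in Hu, Hv.
    specialize (K2 v (Rlt_le_trans _ _ _ Hv (Rmin_r _ _))).
    assert (Hu' := Rlt_le_trans _ _ _ Hu (Rmin_l _ _)).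
    assert (K3 := Rlt_le_trans _ _ _ K2 (Rmin_l _ _)).
    assert (K4 := Rlt_le_trans _ _ _ K2 (Rmin_r _ _)).
    assert (K5 : Cmod (circle_pt u v - q) < d1).
    { unfold q. replace (circle_pt u v - circle_pt r t)%C
        with (RtoC (u - r) * cis v + RtoC r * (cis v - cis t))%C by (rewrite RtoC_minus; ring).
      eapply Rle_lt_trans; [apply Cmod_triangle|].
      rewrite !Cmod_mult, Cmod_cis, !Cmod_R, (Rabs_pos_eq r) by lra.
      assert (G0 := Cmod_ge_0 (cis v - cis t)). nra. }
    specialize (K1 _ K5).
    replace (Re (cis v * G' (circle_pt u v)) - Re (cis t * G' q)) with
      (Re (cis v * (G' (circle_pt u v) - G' q) + (cis v - cis t) * G' q)%C)
      by (unfold Cminus, Copp, Cplus, Cmult, Re, Im; simpl; ring).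
    eapply Rle_lt_trans; [apply re_le_Cmod|]. eapply Rle_lt_trans; [apply Cmod_triangle|].
    rewrite !Cmod_mult, Cmod_cis.
    apply (Rmult_lt_compat_r (1 + Cmod (G' q))) in K4; [|lra].
    replace (eps / (2 * (1 + Cmod (G' q))) * (1 + Cmod (G' q))) with (eps / 2) in K4 by (field; lra).
    assert (G0 := Cmod_ge_0 (cis v - cis t)). nra.
  - eapply filter_imp; [|exact Hnb]. intros u Hu. apply I. exact Hu. }
exists (F (1 / 2)). intros r Hr.
replace (F (1 / 2)) with (F r). { exact (RInt_correct (V:=R_CompleteNormedModule) _ _ _ (I r Hr)). }
destruct (MVT_gen F r (1 / 2) (fun _ => 0)) as [c [_ E]].
- intros x Hx. apply DF. unfold Rmin, Rmax in Hx. destruct (Rle_dec r (1 / 2)); lra.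
- intros x Hx. apply continuity_pt_filterlim.
  apply (ex_derive_continuous (K:=R_AbsRing) (V:=R_NormedModule)). eexists. apply DF.
  unfold Rmin, Rmax in Hx. destruct (Rle_dec r (1 / 2)); lra.
- lra.
Qed.

Definition twice_differentiable (D : C -> Prop) (G : C -> C) : Prop := exists G', derivative_differentiable D G G'.

Lemma twice_differentiable_const D c : twice_differentiable D (fun _ => c).
Proof.
exists (fun _ => RtoC 0). intros z _. split; [apply cder_const|].
eexists. apply cder_const.
Qed.

Lemma twice_differentiable_id D : twice_differentiable D (fun z => z).
Proof.
exists (fun _ => RtoC 1). intros z _. split; [apply cder_id|].
eexists. apply cder_const.
Qed.

Lemma twice_differentiable_plus D f g :
  twice_differentiable D f -> twice_differentiable D g -> twice_differentiable D (fun z => f z + g z)%C.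
Proof.
intros [f' Hf] [g' Hg]. exists (fun z => f' z + g' z)%C. intros z Hz.
destruct (Hf z Hz) as [F1 [a F2]]. destruct (Hg z Hz) as [G1 [b G2]].
split; [now apply cder_plus|]. eexists. apply cder_plus; eassumption.
Qed.

Lemma twice_differentiable_mult D f g :
  twice_differentiable D f -> twice_differentiable D g -> twice_differentiable D (fun z => f z * g z)%C.
Proof.
intros [f' Hf] [g' Hg]. exists (fun z => f' z * g z + f z * g' z)%C. intros z Hz.
destruct (Hf z Hz) as [F1 [a F2]]. destruct (Hg z Hz) as [G1 [b G2]].
split; [now apply cder_mult|].
eexists. apply cder_plus; apply cder_mult; eassumption.
Qed.

Lemma twice_differentiable_opp D f :
  twice_differentiable D f -> twice_differentiable D (fun z => - f z)%C.
Proof.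
intros [f' Hf]. exists (fun z => - f' z)%C. intros z Hz.
destruct (Hf z Hz) as [F1 [a F2]].
split; [now apply cder_opp|]. eexists. apply cder_opp; eassumption.
Qed.

Lemma twice_differentiable_inv (D : C -> Prop) f :
  twice_differentiable D f -> (forall z, D z -> f z <> RtoC 0) ->
  twice_differentiable D (fun z => / f z)%C.
Proof.
intros [f' Hf] H0. exists (fun z => - f' z / (f z * f z))%C. intros z Hz.
destruct (Hf z Hz) as [F1 [a F2]]. specialize (H0 z Hz).
split; [now apply cder_inv|].
eexists. apply cder_div. apply cder_opp; eassumption. apply cder_mult; eassumption.
now apply Cmult_neq_0.
Qed.

Lemma twice_differentiable_pow D n : twice_differentiable D (fun z => z ^ n)%C.
Proof.
induction n as [|n IH]; [exact (twice_differentiable_const D (RtoC 1))|].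
apply (twice_differentiable_mult D (fun z => z)); [apply twice_differentiable_id|exact IH].
Qed.

Lemma twice_differentiable_Csin D f :
  twice_differentiable D f -> twice_differentiable D (fun z => Csin (f z)).
Proof.
intros [f' Hf]. exists (fun z => f' z * Ccos (f z))%C. intros z Hz.
destruct (Hf z Hz) as [F1 [a F2]].
split; [apply cder_comp; [apply cder_Csin|easy]|].
eexists. apply cder_mult. exact F2. apply cder_comp. apply cder_Ccos. exact F1.
Qed.

(** The mean does not depend on the radius and is O(r) as r tends to 0. *)
Lemma circle_mean_zero (G : C -> C) (M d : R) :
  twice_differentiable punctured_disc G -> 0 < d ->
  (forall z, 0 < Cmod z < d -> Cmod (G z) <= M * Cmod z) ->
  forall r, 0 < r < 1 -> is_RInt (fun t => Re (G (circle_pt r t))) 0 (2 * PI) 0.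
Proof.
intros [G' HG] Hd HM. destruct (circle_mean_const G G' HG) as [v Hv].
enough (v = 0) by (subst v; exact Hv).
assert (HPI := PI_RGT_0).
assert (HM' := Rle_abs M). assert (HM0 := Rabs_pos M).
assert (B : forall r, 0 < r < 1 -> r < d -> Rabs v <= 2 * PI * (Rabs M * r)).
{ intros r Hr Hrd.
  replace (2 * PI) with (2 * PI - 0) by ring.
  apply (norm_RInt_le_const (V:=R_NormedModule) (fun t => Re (G (circle_pt r t))) 0 (2 * PI) v).
  - lra.
  - intros t _. eapply Rle_trans; [apply re_le_Cmod|].
    eapply Rle_trans; [apply HM; rewrite Cmod_circle; lra|]. rewrite Cmod_circle by lra. nra.
  - apply Hv. exact Hr. }
destruct (Req_dec v 0) as [E|E]; [exact E|exfalso].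
apply Rabs_pos_lt in E.
(* At this radius the bound [B] falls below |v| / 2, a contradiction. *)
set (r := Rmin (Rmin (1 / 2) (d / 2)) (Rabs v / (4 * PI * (1 + Rabs M)))).
assert (Hp : 0 < 4 * PI * (1 + Rabs M)) by nra.
assert (R0 : 0 < r).
{ apply Rmin_pos; [apply Rmin_pos; lra|]. apply Rdiv_lt_0_compat; lra. }
assert (R1 : r <= Rmin (1 / 2) (d / 2)) by apply Rmin_l.
assert (R2 := Rmin_l (1 / 2) (d / 2)). assert (R3 := Rmin_r (1 / 2) (d / 2)).
assert (R4 : r <= Rabs v / (4 * PI * (1 + Rabs M))) by apply Rmin_r.
specialize (B r ltac:(lra) ltac:(lra)).
apply (Rmult_le_compat_r (4 * PI * (1 + Rabs M))) in R4; [|lra].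
replace (Rabs v / (4 * PI * (1 + Rabs M)) * (4 * PI * (1 + Rabs M))) with (Rabs v) in R4
  by (field; lra).
assert (0 < PI * r) by nra. nra.
Qed.

Lemma Cmod_3_terms (a b c : C) (z : C) : 0 < Cmod z <= 1 ->
  Cmod (a * / z + b * / z ^ 2 + c * / z ^ 3) <= (Cmod a + Cmod b + Cmod c) * / Cmod z ^ 3.
Proof.
intros [H1 H2].
assert (Z : z <> RtoC 0) by now apply Cmod_gt_0.
assert (I : forall n, (n <= 3)%nat -> Cmod (/ z ^ n) <= / Cmod z ^ 3).
{ intros n Hn. rewrite Cmod_inv, Cmod_pow by now apply Cpow_nz.
  apply Rinv_le_contravar; [apply pow_lt; lra|].
  replace 3%nat with (n + (3 - n))%nat by lia. rewrite pow_add.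
  rewrite <- (Rmult_1_r (Cmod z ^ n)) at 2. apply Rmult_le_compat_l; [apply pow_le; lra|].
  rewrite <- (pow1 (3 - n)). apply pow_incr. lra. }
eapply Rle_trans; [apply Cmod_triangle|].
eapply Rle_trans; [apply Rplus_le_compat_r, Cmod_triangle|].
rewrite !Cmod_mult, !Rmult_plus_distr_r.
repeat apply Rplus_le_compat; (apply Rmult_le_compat_l; [apply Cmod_ge_0|]).
- replace (/ z)%C with (/ z ^ 1)%C by (f_equal; simpl; ring). apply I. lia.
- apply I. lia.
- apply I. lia.
Qed.

(* Selecting the rule by the syntactic head avoids costly higher-order unification. *)
Ltac twice_diff :=
  lazymatch goal with
  | |- twice_differentiable ?D (fun _ => ?c) => exact (twice_differentiable_const D c)
  | |- twice_differentiable ?D (fun z => z) => exact (twice_differentiable_id D)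
  | |- twice_differentiable ?D (fun z => z ^ ?n)%C => exact (twice_differentiable_pow D n)
  | |- twice_differentiable ?D (fun z => @?f z + @?g z)%C =>
      apply (twice_differentiable_plus D f g); cbv beta; twice_diff
  | |- twice_differentiable ?D (fun z => @?f z * @?g z)%C =>
      apply (twice_differentiable_mult D f g); cbv beta; twice_diff
  | |- twice_differentiable ?D (fun z => - @?f z)%C =>
      apply (twice_differentiable_opp D f); cbv beta; twice_diff
  | |- twice_differentiable _ (fun z => / z)%C => assumption
  | H : forall n, twice_differentiable _ (fun z => / z ^ n)%C
      |- twice_differentiable _ (fun z => / z ^ ?n)%C => exact (H n)
  | H : twice_differentiable ?D ?g |- twice_differentiable ?D (fun z => ?g z) => exact H
  end.

(* On the circle of radius [rho] the conjugate of [p z = c1 z + c2 z^2 + c3 z^3] equals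
   the Laurent polynomial [L z], so the mean of [Re ((w - p) conj p)] vanishes because
   [(w - p) L] is holomorphic off 0 and tends to 0 there; expanding
   [|w|^2 >= 2 Re ((w - p) conj p) + |p|^2] then bounds the mean of [|p|^2]. *)
Lemma bessel_three_coefficients (w : C -> C) (c1 c2 c3 : C) (M d : R) :
  twice_differentiable unit_disc w ->
  (forall z, unit_disc z -> Cmod (w z) <= 1) ->
  0 < d ->
  (forall z, Cmod z < d -> Cmod (w z - (c1 * z + c2 * z ^ 2 + c3 * z ^ 3)) <= M * Cmod z ^ 4) ->
  Cmod c1 ^ 2 + Cmod c2 ^ 2 + Cmod c3 ^ 2 <= 1.
Proof.
intros Hw Hb Hd HM.
assert (HPI := PI_RGT_0).
assert (K : forall rho, 0 < rho < 1 ->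
  Cmod c1 ^ 2 * rho ^ 2 + Cmod c2 ^ 2 * rho ^ 4 + Cmod c3 ^ 2 * rho ^ 6 <= 1).
{ intros rho Hr.
  set (s := RtoC (rho ^ 2)).
  set (b1 := Cconj c1). set (b2 := Cconj c2). set (b3 := Cconj c3).
  set (p := fun z : C => (c1 * z + c2 * z ^ 2 + c3 * z ^ 3)%C).
  set (L := fun z : C => (b1 * s * / z + b2 * s ^ 2 * / z ^ 2 + b3 * s ^ 3 * / z ^ 3)%C).
  (* On the circle |p|^2 is a constant plus 2 Re (al z + be z^2), these being the cross terms.
     Adding al z + be z^2 to (w - p) L makes |w|^2 = |w - p|^2 + 2 Re G + constant, with a single
     function [G] of mean zero. *)
  set (al := (b1 * c2 * s + b2 * c3 * s ^ 2)%C). set (be := (b1 * c3 * s)%C).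
  set (G := fun z => ((w z + - p z) * L z + (al * z + be * z ^ 2))%C).
  assert (Hw' : twice_differentiable punctured_disc w).
  { destruct Hw as [w' Hw']. exists w'. intros z Hz. apply Hw'. exact (proj2 Hz). }
  assert (Ti : forall n, twice_differentiable punctured_disc (fun z => / z ^ n)%C).
  { intros n. apply twice_differentiable_inv; [apply twice_differentiable_pow|].
    intros z Hz. apply Cpow_nz. apply Cmod_gt_0. exact (proj1 Hz). }
  assert (Ti1 : twice_differentiable punctured_disc (fun z => / z)%C).
  { apply (twice_differentiable_inv _ (fun z => z)); [apply twice_differentiable_id|].
    intros z Hz. apply Cmod_gt_0. exact (proj1 Hz). }
  assert (HG : twice_differentiable punctured_disc G).
  { unfold G, p, L. twice_diff. }
  set (N := Cmod (b1 * s) + Cmod (b2 * s ^ 2) + Cmod (b3 * s ^ 3)).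
  assert (Hd1 : 0 < Rmin d 1) by (apply Rmin_pos; lra).
  assert (Z : is_RInt (fun t => Re (G (circle_pt rho t))) 0 (2 * PI) 0).
  { apply (circle_mean_zero G (M * N + (Cmod al + Cmod be)) (Rmin d 1) HG Hd1); [|exact Hr].
    intros z [Hz1 Hz2].
    assert (Hzd := Rlt_le_trans _ _ _ Hz2 (Rmin_l _ _)).
    assert (Hz3 := Rlt_le_trans _ _ _ Hz2 (Rmin_r _ _)).
    unfold G. eapply Rle_trans; [apply Cmod_triangle|].
    rewrite Rmult_plus_distr_r. apply Rplus_le_compat.
    - rewrite Cmod_mult.
      assert (A := HM z Hzd).
      assert (B := Cmod_3_terms (b1 * s)%C (b2 * s ^ 2)%C (b3 * s ^ 3)%C z (conj Hz1 (Rlt_le _ _ Hz3))).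
      replace (M * N * Cmod z) with ((M * Cmod z ^ 4) * (N * / Cmod z ^ 3)) by (field; lra).
      apply Rmult_le_compat; [apply Cmod_ge_0|apply Cmod_ge_0|exact A|exact B].
    - eapply Rle_trans; [apply Cmod_triangle|]. rewrite !Cmod_mult, Cmod_pow.
      assert (Q := Cmod_ge_0 be). assert (Z2 : Cmod z ^ 2 <= Cmod z) by (simpl; nra).
      assert (Q2 := Rmult_le_compat_l _ _ _ Q Z2). lra. }
  set (k := Cmod c1 ^ 2 * rho ^ 2 + Cmod c2 ^ 2 * rho ^ 4 + Cmod c3 ^ 2 * rho ^ 6).
  set (g := fun t => Re (G (circle_pt rho t))) in *.
  assert (HPI2 : 0 <= 2 * PI) by lra.
  assert (I2 := is_RInt_plus (V:=R_NormedModule) _ _ _ _ _ _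
    (is_RInt_scal (V:=R_NormedModule) g 0 (2 * PI) 2 0 Z)
    (is_RInt_const (V:=R_NormedModule) 0 (2 * PI) k)).
  assert (I3 := is_RInt_le _ _ 0 (2 * PI) _ _ HPI2 I2 (is_RInt_const (V:=R_NormedModule) 0 (2 * PI) 1)).
  enough (P : forall t, 2 * g t + k <= 1).
  { assert (I4 : 2 * 0 + (2 * PI - 0) * k <= (2 * PI - 0) * 1) by (apply I3; intros t _; apply P).
    fold k. nra. }
  intros t. unfold g.
  set (z := circle_pt rho t).
  assert (Hz : Cmod z = rho) by (apply Cmod_circle; lra).
  assert (Hz0 : z <> RtoC 0) by (apply Cmod_gt_0; lra).
  assert (E1 : (z * Cconj z)%C = s).
  { unfold s. rewrite <- Hz. symmetry. apply Cmod2_conj. }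
  assert (ES : L z = Cconj (p z)).
  { unfold L, p. rewrite !Cplus_conj, !Cmult_conj, !Cpow_conj. fold b1 b2 b3. rewrite <- E1.
    field. exact Hz0. }
  assert (EP : (p z * Cconj (p z))%C = (RtoC k + (al * z + be * z ^ 2) + Cconj (al * z + be * z ^ 2))%C).
  { assert (Ek : RtoC k = (c1 * b1 * s + c2 * b2 * s ^ 2 + c3 * b3 * s ^ 3)%C).
    { unfold k, b1, b2, b3. rewrite !RtoC_plus, !RtoC_mult, !Cmod2_conj.
      unfold s. rewrite !RtoC_pow. ring. }
    assert (Es : Cconj s = s) by (unfold s, Cconj, RtoC; simpl; f_equal; ring).
    rewrite Ek. unfold al, be, p.
    rewrite !Cplus_conj, !Cmult_conj, !Cplus_conj, !Cmult_conj, !Cpow_conj, Es.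
    unfold b1, b2, b3. rewrite !Cconj_conj. fold b1 b2 b3. rewrite <- E1. ring. }
  assert (EW : Cmod (w z) ^ 2 = Cmod (w z + - p z) ^ 2 + 2 * Re (G z) + k).
  { unfold G. rewrite ES.
    apply RtoC_inj. rewrite !RtoC_plus, RtoC_mult, !Cmod2_conj, re_alt.
    rewrite (Cplus_conj (_ * _)%C).
    replace (RtoC k) with (p z * Cconj (p z) - (al * z + be * z ^ 2) - Cconj (al * z + be * z ^ 2))%C
      by (rewrite EP; ring).
    rewrite (Cmult_conj (_ + _)%C), Cplus_conj, Copp_conj, Cconj_conj. field. }
  assert (H1 : Cmod (w z) <= 1) by (apply Hb; unfold unit_disc; lra).
  assert (H0 := Cmod_ge_0 (w z)). assert (H2 := pow2_ge_0 (Cmod (w z + - p z))).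
  simpl in EW |- *. fold z. nra. }
set (T := Cmod c1 ^ 2 + Cmod c2 ^ 2 + Cmod c3 ^ 2).
destruct (Rle_lt_dec T 1) as [H|H]; [exact H|exfalso].
(* With rho = 1 - e, Bernoulli's inequality turns [K] into (1 - 6 e) T <= 1; but 6 e T = (T - 1) /
   2, so the left side is (T + 1) / 2 > 1. *)
set (e := (T - 1) / (12 * T)).
assert (He : e * (12 * T) = T - 1) by (unfold e; field; lra).
assert (He0 : 0 < e) by (apply Rdiv_lt_0_compat; lra).
assert (He1 : e < 1 / 12) by nra.
specialize (K (1 - e) ltac:(lra)).
assert (P2 : 1 - 2 * e <= (1 - e) ^ 2) by nra.
assert (P4 : 1 - 4 * e <= (1 - e) ^ 4).
{ replace ((1 - e) ^ 4) with ((1 - e) ^ 2 * (1 - e) ^ 2) by ring. nra. }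
assert (P6 : 1 - 6 * e <= (1 - e) ^ 6).
{ replace ((1 - e) ^ 6) with ((1 - e) ^ 2 * (1 - e) ^ 4) by ring. nra. }
assert (Q1 := pow2_ge_0 (Cmod c1)). assert (Q2 := pow2_ge_0 (Cmod c2)). assert (Q3 := pow2_ge_0 (Cmod c3)).
unfold T in *. nra.
Qed.

(** * Expansions at the origin *)

Lemma Cminus_0_r (z : C) : (z - RtoC 0)%C = z.
Proof. ring. Qed.

(** Landau's O(z^n) at the origin. A third-order Taylor expansion is a remainder with n = 4, and
    such expansions are combined by polynomial algebra instead of differentiation. *)
Definition near0_bounded (n : nat) (g : C -> C) : Prop :=
  exists M d, 0 < d /\ 0 <= M /\ forall z, Cmod z < d -> Cmod (g z) <= M * Cmod z ^ n.

Lemma near0_bounded_const c : near0_bounded 0 (fun _ => c).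
Proof. exists (Cmod c), 1. split; [lra|]. split; [apply Cmod_ge_0|]. intros z _. simpl. lra. Qed.

Lemma near0_bounded_pow n : near0_bounded n (fun z => z ^ n)%C.
Proof. exists 1, 1. repeat split; try lra. intros z _. rewrite Cmod_pow. lra. Qed.

Lemma near0_bounded_plus n f g :
  near0_bounded n f -> near0_bounded n g -> near0_bounded n (fun z => f z + g z)%C.
Proof.
intros [M1 [d1 [D1 [P1 H1]]]] [M2 [d2 [D2 [P2 H2]]]].
exists (M1 + M2), (Rmin d1 d2). split; [now apply Rmin_pos|]. split; [lra|].
intros z Hz. specialize (H1 z (Rlt_le_trans _ _ _ Hz (Rmin_l _ _))).
specialize (H2 z (Rlt_le_trans _ _ _ Hz (Rmin_r _ _))).
eapply Rle_trans; [apply Cmod_triangle|]. lra.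
Qed.

Lemma near0_bounded_mult n m f g :
  near0_bounded n f -> near0_bounded m g -> near0_bounded (n + m) (fun z => f z * g z)%C.
Proof.
intros [M1 [d1 [D1 [P1 H1]]]] [M2 [d2 [D2 [P2 H2]]]].
exists (M1 * M2), (Rmin d1 d2). split; [now apply Rmin_pos|]. split; [now apply Rmult_le_pos|].
intros z Hz. specialize (H1 z (Rlt_le_trans _ _ _ Hz (Rmin_l _ _))).
specialize (H2 z (Rlt_le_trans _ _ _ Hz (Rmin_r _ _))).
rewrite Cmod_mult, pow_add.
replace (M1 * M2 * (Cmod z ^ n * Cmod z ^ m)) with ((M1 * Cmod z ^ n) * (M2 * Cmod z ^ m)) by ring.
apply Rmult_le_compat; auto using Cmod_ge_0.
Qed.

Lemma near0_bounded_ext n f g d : 0 < d ->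
  (forall z, Cmod z < d -> f z = g z) -> near0_bounded n f -> near0_bounded n g.
Proof.
intros Hd E [M1 [d1 [D1 [P1 H1]]]].
exists M1, (Rmin d1 d). split; [now apply Rmin_pos|]. split; [easy|].
intros z Hz. rewrite <- E by exact (Rlt_le_trans _ _ _ Hz (Rmin_r _ _)).
apply H1. exact (Rlt_le_trans _ _ _ Hz (Rmin_l _ _)).
Qed.

Lemma near0_bounded_weaken n m f : (m <= n)%nat -> near0_bounded n f -> near0_bounded m f.
Proof.
intros L [M1 [d1 [D1 [P1 H1]]]].
exists M1, (Rmin d1 1). split; [apply Rmin_pos; lra|]. split; [easy|].
intros z Hz. eapply Rle_trans; [apply H1; exact (Rlt_le_trans _ _ _ Hz (Rmin_l _ _))|].
assert (Hz1 := Rlt_le_trans _ _ _ Hz (Rmin_r _ _)). assert (Hz0 := Cmod_ge_0 z).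
apply Rmult_le_compat_l; [easy|].
replace n with (m + (n - m))%nat by lia. rewrite pow_add.
rewrite <- (Rmult_1_r (Cmod z ^ m)) at 2. apply Rmult_le_compat_l; [apply pow_le; lra|].
rewrite <- (pow1 (n - m)). apply pow_incr. lra.
Qed.

Lemma near0_bounded_inv (f : C -> C) (l : C) : cder f (RtoC 0) l -> f (RtoC 0) <> RtoC 0 ->
  near0_bounded 0 (fun z => / f z)%C.
Proof.
intros Hf H0. assert (P : 0 < Cmod (f (RtoC 0))) by now apply Cmod_gt_0.
destruct (cder_continuous f _ l Hf (Cmod (f (RtoC 0)) / 2)) as [d [Hd H]]; [lra|].
exists (/ (Cmod (f (RtoC 0)) / 2)), d. split; [easy|].
split. { apply Rlt_le, Rinv_0_lt_compat; lra. }
intros z Hz. specialize (H z). rewrite Cminus_0_r in H. specialize (H Hz).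
assert (Q : Cmod (f (RtoC 0)) / 2 <= Cmod (f z)).
{ assert (T := Cmod_triangle (- (f z - f (RtoC 0))) (f z)). rewrite Cmod_opp in T.
  replace (- (f z - f (RtoC 0)) + f z)%C with (f (RtoC 0)) in T by ring. lra. }
assert (N : f z <> RtoC 0) by (apply Cmod_gt_0; lra).
rewrite Cmod_inv by exact N. simpl. rewrite Rmult_1_r.
apply Rinv_le_contravar; lra.
Qed.

Lemma power_series_jet a f : power_series a f ->
  near0_bounded 4 (fun z => f z - (a 0%nat + a 1%nat * z + a 2%nat * z ^ 2 + a 3%nat * z ^ 3))%C.
Proof.
intros H.
assert (X := ex_series_radius _ (1 / 2) (power_series_radius a f (1 / 2) H ltac:(lra))).
do 4 apply ex_series_incr_1 in X. destruct X as [N HN].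
(* [N] is the sum from index 4 of the moduli at radius 1 / 2; the factor 16 undoes (1 / 2)^4 when
   |z|^4 is taken out. *)
exists (16 * Rabs N), (1 / 2). split; [lra|]. assert (NP := Rabs_pos N). split; [lra|].
intros z Hz. assert (Hz0 := Cmod_ge_0 z).
assert (S1 := H z ltac:(lra)). do 4 apply cseries_shift in S1.
assert (HN' := is_series_scal (K:=R_AbsRing) (V:=R_NormedModule) (16 * Cmod z ^ 4) _ _ HN).
match type of S1 with cseries _ ?l =>
  replace (f z - (a 0%nat + a 1%nat * z + a 2%nat * z ^ 2 + a 3%nat * z ^ 3))%C with l
    by (simpl; ring) end.
apply Rle_trans with (16 * Cmod z ^ 4 * N).
2:{ assert (Q := Rle_abs N). assert (0 <= 16 * Cmod z ^ 4) by (assert (G := pow_le _ 4 Hz0); lra). nra. }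
refine (cseries_norm_le _ _ _ _ S1 HN' _). intros n.
change (Cmod (a (S (S (S (S n)))) * z ^ S (S (S (S n)))) <=
   16 * Cmod z ^ 4 * (Cmod (a (S (S (S (S n))))) * (1 / 2) ^ S (S (S (S n))))).
rewrite Cmod_mult, Cmod_pow.
replace (16 * Cmod z ^ 4 * (Cmod (a (S (S (S (S n))))) * (1 / 2) ^ S (S (S (S n)))))
  with (Cmod (a (S (S (S (S n))))) * (Cmod z ^ 4 * (1 / 2) ^ n)) by (simpl; field).
apply Rmult_le_compat_l; [apply Cmod_ge_0|].
replace (S (S (S (S n)))) with (4 + n)%nat by lia. rewrite pow_add.
apply Rmult_le_compat_l; [apply pow_le; lra|]. apply pow_incr; lra.
Qed.

(** The mean value inequality on the segment from 0 plays the role of integration and gains one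
    power of |u|. The constant is not improved by 1 / (n + 1), as only the order matters. *)
Lemma derivative_vanishing_order (g g' : C -> C) (K : R) (n : nat) :
  0 <= K -> (forall u, cder g u (g' u)) -> g (RtoC 0) = RtoC 0 ->
  (forall u, Cmod u <= 1 -> Cmod (g' u) <= K * Cmod u ^ n) ->
  forall u, Cmod u <= 1 -> Cmod (g u) <= K * Cmod u ^ S n.
Proof.
intros HK D G0 B u Hu.
assert (Q := mean_value_ineq g g' (RtoC 0) u (K * Cmod u ^ n)).
rewrite G0 in Q. replace (g u - RtoC 0)%C with (g u) in Q by ring.
replace (u - RtoC 0)%C with u in Q by ring.
replace (K * Cmod u ^ S n) with (K * Cmod u ^ n * Cmod u) by (simpl; ring).
apply Q. intros t Ht. split; [apply D|]. rewrite Cplus_0_l.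
assert (T : Cmod (RtoC t * u) <= Cmod u).
{ rewrite Cmod_mult, Cmod_R, Rabs_pos_eq by lra. assert (G := Cmod_ge_0 u). nra. }
eapply Rle_trans; [apply B; lra|]. apply Rmult_le_compat_l; [exact HK|].
apply pow_incr. split; [apply Cmod_ge_0|exact T].
Qed.

Lemma Csin_0 : Csin (RtoC 0) = RtoC 0.
Proof.
unfold Csin. replace (Ci * RtoC 0)%C with (RtoC 0) by ring.
replace (- RtoC 0)%C with (RtoC 0) by ring. field. apply Ci_neq_0.
Qed.

Lemma Ccos_0 : Ccos (RtoC 0) = RtoC 1.
Proof.
unfold Ccos. replace (Ci * RtoC 0)%C with (RtoC 0) by ring.
replace (- RtoC 0)%C with (RtoC 0) by ring. rewrite Cexp_0. field.
Qed.

(** The bound |sin u| <= e on the unit disc is integrated four times, through 1 - cos u, u - sin u,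
    cos u - 1 + u^2 / 2 and finally sin u - u + u^3 / 6, all of which vanish at 0. *)
Lemma Csin_Taylor : exists K, 0 <= K /\ forall u, Cmod u <= 1 ->
  Cmod (Csin u - u + u ^ 3 / 6) <= K * Cmod u ^ 4.
Proof.
exists (exp 1). assert (E := exp_pos 1). split; [lra|].
assert (B0 : forall u, Cmod u <= 1 -> Cmod (Csin u) <= exp 1 * Cmod u ^ 0).
{ intros u Hu. simpl. rewrite Rmult_1_r.
  assert (X : forall v : C, Cmod v <= 1 -> Cmod (Cexp v) <= exp 1).
  { intros v Hv. rewrite Cmod_Cexp. assert (Q := Cmod_Re_bounds v).
    destruct (Req_dec (Re v) 1) as [->|Z]; [lra|]. apply Rlt_le, exp_increasing. lra. }
  assert (X1 := X (Ci * u)%C ltac:(rewrite Cmod_mult, Cmod_Ci; lra)).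
  assert (X2 := X (- (Ci * u))%C ltac:(rewrite Cmod_opp, Cmod_mult, Cmod_Ci; lra)).
  assert (N : (2 * Ci)%C <> RtoC 0) by (apply Cmult_neq_0; [apply C2_neq_0|apply Ci_neq_0]).
  unfold Csin. rewrite (Cmod_div _ _ N), Cmod_mult, Cmod_Ci, Cmod_R, Rabs_pos_eq by lra.
  assert (T := Cmod_triangle (Cexp (Ci * u)) (- Cexp (- (Ci * u)))). rewrite Cmod_opp in T.
  unfold Cminus. lra. }
assert (B1 := derivative_vanishing_order (fun u => RtoC 1 - Ccos u)%C Csin (exp 1) 0 (Rlt_le _ _ E)).
assert (B2 := derivative_vanishing_order (fun u => u - Csin u)%C (fun u => RtoC 1 - Ccos u)%C (exp 1) 1 (Rlt_le _ _ E)).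
assert (B3 := derivative_vanishing_order (fun u => Ccos u - 1 + u ^ 2 / 2)%C (fun u => u - Csin u)%C (exp 1) 2 (Rlt_le _ _ E)).
assert (B4 := derivative_vanishing_order (fun u => Csin u - u + u ^ 3 / 6)%C (fun u => Ccos u - 1 + u ^ 2 / 2)%C (exp 1) 3 (Rlt_le _ _ E)).
cbv beta in *.
apply B4; [| |apply B3; [| |apply B2; [| |apply B1; [| |exact B0]]]].
- intros u. eapply cder_eq. apply cder_plus. apply cder_minus. apply cder_Csin. apply cder_id.
  apply (cder_div (fun u => u ^ 3)%C (fun _ => RtoC 6)). apply cder_pow. apply cder_const.
  intros H; apply RtoC_inj in H; lra. simpl INR. rewrite !RtoC_plus. cbv beta. field.
- rewrite Csin_0. simpl. field.
- intros u. eapply cder_eq. apply cder_plus. apply cder_minus. apply cder_Ccos. apply cder_const.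
  apply (cder_div (fun u => u ^ 2)%C (fun _ => RtoC 2)). apply cder_pow. apply cder_const.
  apply C2_neq_0. simpl INR. rewrite !RtoC_plus. cbv beta. field.
- rewrite Ccos_0. simpl. field.
- intros u. apply cder_minus. apply cder_id. apply cder_Csin.
- rewrite Csin_0. ring.
- intros u. eapply cder_eq. apply cder_minus. apply cder_const. apply cder_Ccos. ring.
- rewrite Ccos_0. ring.
Qed.

Lemma is_derive_sum_squares (u v : R -> R) t a b :
  is_derive u t a -> is_derive v t b ->
  is_derive (fun s => u s ^ 2 + v s ^ 2) t (2 * (u t * a + v t * b)).
Proof.
intros Hu Hv. auto_derive; [split; [eexists; exact Hu|split; [eexists; exact Hv|exact Logic.I]]|].
change (fun x : R => u x) with u. change (fun x : R => v x) with v.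
rewrite (is_derive_unique _ _ _ Hu), (is_derive_unique _ _ _ Hv). ring.
Qed.

(** The product h(t) exp (L t) has nonnegative derivative, so it stays at least its positive initial
    value. *)
Lemma gronwall_positive (h h' : R -> R) (a b L : R) :
  a <= b -> (forall t, a <= t <= b -> is_derive h t (h' t)) ->
  (forall t, a <= t <= b -> - L * h t <= h' t) -> 0 < h a -> 0 < h b.
Proof.
intros Hab D B Ha.
set (k := fun t => h t * exp (L * t)).
assert (Dk : forall t, a <= t <= b -> is_derive k t (h' t * exp (L * t) + h t * (L * exp (L * t)))).
{ intros t Ht. unfold k. specialize (D t Ht). auto_derive.
  - eexists; exact D.
  - change (fun x : R => h x) with h. rewrite (is_derive_unique _ _ _ D). ring. }
destruct (MVT_gen k a b (fun t => h' t * exp (L * t) + h t * (L * exp (L * t)))) as [c [Hc E]].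
- rewrite Rmin_left, Rmax_right by lra. intros x Hx. apply Dk; lra.
- rewrite Rmin_left, Rmax_right by lra. intros x Hx. apply continuity_pt_filterlim.
  apply (ex_derive_continuous (K:=R_AbsRing) (V:=R_NormedModule)). eexists. apply Dk; lra.
- rewrite Rmin_left, Rmax_right in Hc by lra. specialize (B c Hc).
  assert (P := exp_pos (L * c)). assert (Pb := exp_pos (L * b)). assert (Pa := exp_pos (L * a)).
  assert (0 <= (h' c * exp (L * c) + h c * (L * exp (L * c))) * (b - a)).
  { apply Rmult_le_pos; [|lra].
    replace (h' c * exp (L * c) + h c * (L * exp (L * c))) with ((h' c - - L * h c) * exp (L * c)) by ring.
    apply Rmult_le_pos; lra. }
  unfold k in E. assert (0 < h a * exp (L * a)) by nra. nra.
Qed.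

(* Gronwall's inequality for [|g|^2] along a radius; no bound on [g'] is needed at a zero of [g]
   because [|g|^2] has derivative 0 there. *)
Lemma nonvanishing_of_log_derivative (g g' : C -> C) (K : R) :
  (forall z, unit_disc z -> cder g z (g' z)) -> g (RtoC 0) <> RtoC 0 ->
  (forall z, unit_disc z -> g z <> RtoC 0 -> Cmod (z * g' z) <= K * Cmod (g z)) ->
  forall z, unit_disc z -> g z <> RtoC 0.
Proof.
intros D G0 B z Hz. unfold unit_disc in *.
assert (Hz0 := Cmod_ge_0 z).
destruct (cder_continuous g _ _ (D (RtoC 0) ltac:(rewrite Cmod_0; lra)) (Cmod (g (RtoC 0)))) as [d [Hd Hc]].
{ now apply Cmod_gt_0. }
(* The hypothesis controls z g' and not g', so on the radius t z it bounds the derivative only with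
   a factor 1 / t. Starting at t = e makes this at most 1 / e, and e is small enough that [g] is
   nonzero at the starting point by continuity. *)
set (e := Rmin (1 / 2) (d / 2)).
assert (He : 0 < e) by (apply Rmin_pos; lra).
assert (He1 : e <= 1 / 2) by apply Rmin_l. assert (He2 : e <= d / 2) by apply Rmin_r.
set (c := fun t => (RtoC 0 + RtoC t * z)%C).
assert (Dom : forall t, 0 <= t <= 1 -> Cmod (c t) < 1).
{ intros t Ht. unfold c. rewrite Cplus_0_l, Cmod_mult, Cmod_R, Rabs_pos_eq by lra. nra. }
(* [Re (- Ci * g)] is the imaginary part of [g], in a form to which [curve_der_Re] applies. *)
set (h := fun t => Re (g (c t)) ^ 2 + Re (- Ci * g (c t))%C ^ 2).
set (h' := fun t => 2 * Re (Cconj (g (c t)) * (z * g' (c t)))%C).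
assert (hE : forall t, h t = Cmod (g (c t)) ^ 2).
{ intros t. unfold h. rewrite Cmod2_alt. unfold Ci, Copp, Cmult, Re, Im; simpl. ring. }
assert (P : 0 < h 1).
{ apply (gronwall_positive h h' e 1 (2 * (Rabs K / e))).
  - lra.
  - intros t Ht.
    assert (D1 : is_derive (fun t => Re (g (c t))) t (Re (z * g' (c t)))).
    { apply curve_der_Re. apply curve_der_comp. apply D. apply Dom. lra. apply curve_der_segment. }
    assert (D2 : is_derive (fun t => Re (- Ci * g (c t))%C) t (Re (z * (- Ci * g' (c t))))).
    { apply curve_der_Re. apply (curve_der_comp (fun y => - Ci * g y)%C c). apply cder_scal.
      apply D. apply Dom. lra. apply curve_der_segment. }
    replace (h' t) with (2 * (Re (g (c t)) * Re (z * g' (c t)) + Re (- Ci * g (c t)) * Re (z * (- Ci * g' (c t))))).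
    exact (is_derive_sum_squares _ _ _ _ _ D1 D2).
    unfold h', Ci, Copp, Cconj, Cmult, Re, Im; simpl. ring.
  - intros t Ht. rewrite hE. unfold h'.
    assert (A : Cmod (g (c t)) * Cmod (z * g' (c t)) <= Rabs K / e * Cmod (g (c t)) ^ 2).
    { destruct (Req_dec (Cmod (g (c t))) 0) as [Z|Z]; [rewrite Z; simpl; lra|].
      assert (N : g (c t) <> RtoC 0). { intros N. apply Z. rewrite N. apply Cmod_0. }
      specialize (B (c t) (Dom t ltac:(lra)) N).
      assert (X : t * Cmod (z * g' (c t)) <= Rabs K * Cmod (g (c t))).
      { replace (t * Cmod (z * g' (c t))) with (Cmod (c t * g' (c t))).
        - eapply Rle_trans; [exact B|]. apply Rmult_le_compat_r; [apply Cmod_ge_0|apply Rle_abs].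
        - unfold c at 1. rewrite Cplus_0_l, !Cmod_mult, Cmod_R, Rabs_pos_eq by lra. ring. }
      assert (G1 := Cmod_ge_0 (g (c t))). assert (G2 := Cmod_ge_0 (z * g' (c t))).
      assert (Y : Cmod (z * g' (c t)) <= Rabs K / e * Cmod (g (c t))).
      { apply (Rmult_le_reg_l e); [lra|].
        replace (e * (Rabs K / e * Cmod (g (c t)))) with (Rabs K * Cmod (g (c t))) by (field; lra).
        nra. }
      nra. }
    assert (R1 := Cmod_Re_bounds (Cconj (g (c t)) * (z * g' (c t)))%C).
    rewrite Cmod_mult, Cmod_conj in R1. lra.
  - rewrite hE. apply pow_lt. apply Cmod_gt_0. intros N.
    specialize (Hc (c e)). rewrite N in Hc.
    rewrite Cminus_0_r in Hc. unfold c in Hc. rewrite Cplus_0_l in Hc.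
    replace (RtoC 0 - g (RtoC 0))%C with (- g (RtoC 0))%C in Hc by ring.
    rewrite Cmod_opp, Cmod_mult, Cmod_R, Rabs_pos_eq in Hc by lra.
    assert (e * Cmod z < d) by nra. specialize (Hc H). lra. }
rewrite hE in P. replace (c 1) with z in P by (unfold c; ring).
intros N. rewrite N, Cmod_0 in P. simpl in P. lra.
Qed.

Lemma near0_bounded_id : near0_bounded 0 (fun z => z).
Proof. exists 1, 1. repeat split; try lra. intros z Hz. simpl. lra. Qed.

Ltac near0_poly :=
  cbv beta;
  lazymatch goal with
  | |- near0_bounded 0 (fun _ => ?c) => exact (near0_bounded_const c)
  | |- near0_bounded 0 (fun z => z) => exact near0_bounded_id
  | |- near0_bounded 0 (fun z => z ^ ?n)%C =>
      exact (near0_bounded_weaken n 0 _ (Nat.le_0_l n) (near0_bounded_pow n))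
  | |- near0_bounded 0 (fun z => @?f z + @?g z)%C =>
      apply (near0_bounded_plus 0 f g); near0_poly
  | |- near0_bounded 0 (fun z => @?f z * @?g z)%C =>
      apply (near0_bounded_mult 0 0 f g); near0_poly
  | H : near0_bounded 0 ?g |- near0_bounded 0 (fun z => ?g z) => exact H
  | H : near0_bounded 0 ?g |- near0_bounded 0 ?g => exact H
  end.

Lemma Csin_jet (Q : C -> C) (q1 q2 q3 : C) :
  near0_bounded 4 (fun z => Q z - (q1 * z + q2 * z ^ 2 + q3 * z ^ 3))%C ->
  near0_bounded 4 (fun z => Csin (Q z) - (q1 * z + q2 * z ^ 2 + (q3 - q1 ^ 3 / 6) * z ^ 3))%C.
Proof.
intros HE.
set (P := fun z : C => (q1 * z + q2 * z ^ 2 + q3 * z ^ 3)%C) in *.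
set (E := fun z => (Q z - P z)%C).
assert (HE0 : near0_bounded 0 E) by exact (near0_bounded_weaken 4 0 _ (Nat.le_0_l 4) HE).
assert (HP0 : near0_bounded 0 P) by (unfold P; near0_poly).
assert (HQ0 : near0_bounded 0 Q).
{ apply (near0_bounded_ext 0 (fun z => P z + E z)%C Q 1); [lra| |near0_poly].
  intros z _. unfold E. ring. }
assert (HQ1 : near0_bounded 1 Q).
{ apply (near0_bounded_ext 1 (fun z => z ^ 1 * (q1 + q2 * z + q3 * z ^ 2) + E z)%C Q 1); [lra| |].
  - intros z _. unfold E, P. simpl. ring.
  - apply near0_bounded_plus; [|exact (near0_bounded_weaken 4 1 _ ltac:(lia) HE)].
    apply (near0_bounded_mult 1 0 (fun z => z ^ 1)%C); [apply near0_bounded_pow|near0_poly]. }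
assert (HS : near0_bounded 4 (fun z => Csin (Q z) - Q z + Q z ^ 3 / 6)%C).
{ destruct Csin_Taylor as [K [HK T]]. destruct HQ1 as [M [d [Hd [HM B]]]].
  (* The radius 1 / (1 + M) forces |Q z| <= 1, the range of the Taylor estimate. *)
  exists (K * M ^ 4), (Rmin d (/ (1 + M))).
  split; [apply Rmin_pos; [easy|apply Rinv_0_lt_compat; lra]|].
  split; [apply Rmult_le_pos; [easy|apply pow_le; easy]|].
  intros z Hz. assert (Hz1 := Rlt_le_trans _ _ _ Hz (Rmin_l _ _)).
  assert (Hz2 := Rlt_le_trans _ _ _ Hz (Rmin_r _ _)). assert (Hz0 := Cmod_ge_0 z).
  specialize (B z Hz1). simpl in B. rewrite Rmult_1_r in B.
  apply (Rmult_lt_compat_l (1 + M)) in Hz2; [|lra]. rewrite Rinv_r in Hz2 by lra.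
  assert (Q1 : Cmod (Q z) <= 1) by nra.
  eapply Rle_trans; [apply (T _ Q1)|].
  rewrite Rmult_assoc, <- Rpow_mult_distr. apply Rmult_le_compat_l; [easy|].
  apply pow_incr. split; [apply Cmod_ge_0|exact B]. }
set (s := fun z : C => (q2 + q3 * z)%C).
(* With P = z (q1 + z s), expanding the cube gives P^3 = q1^3 z^3 + z^4 R. *)
set (R := fun z : C => (3 * q1 ^ 2 * s z + 3 * q1 * (z * (s z * s z)) + z ^ 2 * (s z * (s z * s z)))%C).
assert (Hs : near0_bounded 0 s) by (unfold s; near0_poly).
assert (HR : near0_bounded 0 R) by (unfold R; near0_poly).
(* The three pieces are the Taylor error of the sine, the effect of replacing Q by P through Q^3 -
   P^3 = E (Q^2 + Q P + P^2), and the terms of P^3 of degree at least 4. *)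
apply (near0_bounded_ext 4 (fun z => (Csin (Q z) - Q z + Q z ^ 3 / 6)
   + (E z * (1 + - / 6 * (Q z * Q z + Q z * P z + P z * P z)) + z ^ 4 * (- / 6 * R z)))%C _ 1); [lra| |].
- intros z _. unfold E, R, s, P. field.
- apply near0_bounded_plus; [exact HS|]. apply near0_bounded_plus.
  + apply (near0_bounded_mult 4 0 E); [exact HE|near0_poly].
  + apply (near0_bounded_mult 4 0 (fun z => z ^ 4)%C); [apply near0_bounded_pow|near0_poly].
Qed.

(** * The coefficient bound *)

(** With x, y, t the three moduli, 1 / PI <= 1 / 3 gives x y / PI <= (x^2 + y^2) / 6, and the cubic
    term is at most x^2 / 18. The total is at most t + (x^2 + y^2) / 2 <= t + (1 - t^2) / 2 = 1 - (1
    - t)^2 / 2. *)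
Lemma coefficient_inequality (c1 c2 c3 : C) :
  Cmod c1 ^ 2 + Cmod c2 ^ 2 + Cmod c3 ^ 2 <= 1 ->
  Cmod (c3 + RtoC (/ PI) * c1 * c2 + RtoC (/ 6 - 2 / PI ^ 2) * c1 ^ 3) <= 1.
Proof.
intros H. assert (P3 : 3 < PI) by (assert (Q := PI2_3_2); unfold PI2 in Q; lra).
assert (P4 : PI <= 4) by exact PI_4.
assert (I1 : 0 < / PI <= / 3).
{ split; [apply Rinv_0_lt_compat; lra|apply Rinv_le_contravar; lra]. }
assert (I2 : / 4 <= / PI) by (apply Rinv_le_contravar; lra).
(* For 3 < PI <= 4 the number 2 / PI^2 lies between 1 / 8 and 2 / 9, and 1 / 6 - 2 / 9 = - 1 / 18 is
   the worse end. *)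
assert (N : Rabs (/ 6 - 2 / PI ^ 2) <= / 18).
{ replace (2 / PI ^ 2) with (2 * (/ PI * / PI)) by (field; lra).
  apply Rabs_le. split; nra. }
eapply Rle_trans; [apply Cmod_triangle|].
eapply Rle_trans; [apply Rplus_le_compat_r, Cmod_triangle|].
rewrite !Cmod_mult, Cmod_pow, !Cmod_R, (Rabs_pos_eq (/ PI)) by lra.
assert (G1 := Cmod_ge_0 c1). assert (G2 := Cmod_ge_0 c2). assert (G3 := Cmod_ge_0 c3).
set (x := Cmod c1) in *. set (y := Cmod c2) in *. set (t := Cmod c3) in *.
set (n := Rabs (/ 6 - 2 / PI ^ 2)) in *.
assert (x <= 1) by nra.
assert (A : / PI * x * y <= / 6 * (x ^ 2 + y ^ 2)).
{ assert (/ PI * (x * y) <= / 3 * (x * y)) by (apply Rmult_le_compat_r; nra).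
  assert (0 <= (x - y) ^ 2) by apply pow2_ge_0. nra. }
assert (B : n * x ^ 3 <= / 18 * x ^ 2).
{ apply Rmult_le_compat; [apply Rabs_pos|apply pow_le; lra|easy|]. simpl. nra. }
assert (0 <= (1 - t) ^ 2) by apply pow2_ge_0. nra.
Qed.

Lemma a2a3_a4_bound (f : C -> C) (a : nat -> C) :
  class_C_arcsin f -> normalized_expansion f a ->
  Cmod (a 2%nat * a 3%nat - a 4%nat)%C <= 1 / (6 * PI).
Proof.
intros [_ [w [[_ [w0 wb]] Hsub]]] [_ [Ha1 Hser]].
assert (HPI := PI_RGT_0).
assert (PS0 : power_series a f).
{ intros z Hz. exact (proj1 (is_pseries_cseries a z (f z)) (Hser z Hz)). }
set (f1 := power_sum (coef_derive a)). set (f2 := power_sum (coef_derive (coef_derive a))).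
destruct (power_series_derive a f PS0) as [PS1 D0].
destruct (power_series_derive _ _ PS1) as [PS2 D1].
destruct (power_series_derive _ _ PS2) as [PS3 D2].
destruct (power_series_derive _ _ PS3) as [_ D3].
fold f1 in PS1, D0, D1. fold f2 in PS2, D1, D2.
assert (E1 : forall z, Cmod z < 1 -> C_derive f z = f1 z).
{ intros z Hz. apply is_C_derive_unique. exact (D0 z Hz). }
assert (E2 : forall z, Cmod z < 1 -> C_derive (C_derive f) z = f2 z).
{ intros z Hz. apply is_C_derive_unique.
  (* [C_derive f] is known to agree with [f1] only inside the disc, and the ball of radius 1 - |z|
     stays there. *)
  apply (cder_ext_loc f1 (C_derive f) z (f2 z) (1 - Cmod z)); [lra| |apply D1; exact Hz].
  intros y Hy. symmetry. apply E1. replace y with ((y - z) + z)%C by ring.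
  eapply Rle_lt_trans; [apply Cmod_triangle|]. lra. }
assert (f10 : f1 (RtoC 0) = RtoC 1).
{ rewrite (power_series_0 _ _ PS1). unfold coef_derive. rewrite Ha1. simpl. ring. }
set (b := RtoC (2 / PI)). set (k := RtoC (PI / 2)).
assert (kb : (k * b)%C = RtoC 1) by (unfold k, b; rewrite <- RtoC_mult; f_equal; field; lra).
assert (Eq : forall z, Cmod z < 1 -> (z * f2 z / f1 z)%C = (b * Carcsin (w z))%C).
{ intros z Hz. assert (Q := Hsub z Hz). cbv beta in Q. rewrite E2, E1 in Q by exact Hz.
  fold b in Q. set (l := (z * f2 z / f1 z)%C) in *. set (r := (b * Carcsin (w z))%C) in *.
  replace l with ((1 + l) - 1)%C by ring. rewrite Q. ring. }
(* Here the quotient in [Eq] could still be a default value, so [Eq] is used only where [f1 z] is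
   nonzero. There the bounded arcsine gives |z f2| <= (2 / PI) M |f1|, which excludes zeros
   altogether. *)
assert (Nz : forall z, Cmod z < 1 -> f1 z <> RtoC 0).
{ destruct Carcsin_bounded as [M HM].
  apply (nonvanishing_of_log_derivative f1 f2 (2 / PI * M)).
  - intros z Hz. apply D1. exact Hz.
  - rewrite f10. intros X. apply RtoC_inj in X. lra.
  - intros z Hz N. replace (z * f2 z)%C with ((z * f2 z / f1 z) * f1 z)%C by (field; exact N).
    rewrite Eq by exact Hz. rewrite !Cmod_mult. apply Rmult_le_compat_r; [apply Cmod_ge_0|].
    unfold b. assert (0 < 2 / PI) by (apply Rdiv_lt_0_compat; lra).
    rewrite Cmod_R, Rabs_pos_eq by lra.
    apply Rmult_le_compat_l; [lra|]. apply HM. apply wb. exact Hz. }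
(* [Q] is arcsin (w z) expressed through power series; its sine is [w], which thereby becomes twice
   differentiable. *)
set (Q := fun z => (k * (z * f2 z) * / f1 z)%C).
assert (wQ : forall z, Cmod z < 1 -> Csin (Q z) = w z).
{ intros z Hz. rewrite <- (Csin_Carcsin (w z)). f_equal. unfold Q.
  replace (k * (z * f2 z) * / f1 z)%C with (k * (z * f2 z / f1 z))%C by (unfold Cdiv; ring).
  rewrite Eq by exact Hz. rewrite Cmult_assoc, kb. ring. }
assert (T1 : twice_differentiable unit_disc f1).
{ exists f2. intros z Hz. split; [apply D1; exact Hz|]. eexists. apply D2. exact Hz. }
assert (T2 : twice_differentiable unit_disc f2).
{ eexists. intros z Hz. split; [apply D2; exact Hz|]. eexists. apply D3. exact Hz. }
assert (T3 : twice_differentiable unit_disc (fun z => / f1 z)%C).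
{ apply twice_differentiable_inv; [exact T1|exact Nz]. }
assert (TQ : twice_differentiable unit_disc Q).
{ unfold Q. apply (twice_differentiable_mult _ (fun z => k * (z * f2 z))%C (fun z => / f1 z)%C); [|exact T3].
  twice_diff. }
(* The Taylor coefficients of [Q], solved recursively from Q f1 = k z f2 with f1 (0) = 1. *)
set (q1 := (k * coef_derive (coef_derive a) 0)%C).
set (q2 := (k * coef_derive (coef_derive a) 1 - coef_derive a 1 * q1)%C).
set (q3 := (k * coef_derive (coef_derive a) 2 - coef_derive a 1 * q2 - coef_derive a 2 * q1)%C).
assert (a11 : coef_derive a 0 = RtoC 1) by (unfold coef_derive; rewrite Ha1; simpl; ring).
assert (JQ : near0_bounded 4 (fun z => Q z - (q1 * z + q2 * z ^ 2 + q3 * z ^ 3))%C).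
{ assert (J1 := power_series_jet _ _ PS1). assert (J2 := power_series_jet _ _ PS2).
  rewrite a11 in J1.
  set (b1 := coef_derive a 1) in *. set (b2 := coef_derive a 2) in *. set (b3 := coef_derive a 3) in *.
  set (e0 := coef_derive (coef_derive a) 0) in *. set (e1 := coef_derive (coef_derive a) 1) in *.
  set (e2 := coef_derive (coef_derive a) 2) in *. set (e3 := coef_derive (coef_derive a) 3) in *.
  match type of J1 with near0_bounded 4 ?r => set (r1 := r) in * end.
  match type of J2 with near0_bounded 4 ?r => set (r2 := r) in * end.
  assert (I1 : near0_bounded 0 (fun z => / f1 z)%C).
  { apply (near0_bounded_inv f1 (f2 (RtoC 0))).
    - apply D1. rewrite Cmod_0. lra.
    - rewrite f10. intros X. apply RtoC_inj in X. lra. }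
  set (p := fun z : C => (q1 * z + q2 * z ^ 2 + q3 * z ^ 3)%C).
  (* z^4 h is what remains of k z (jet of f2) - (jet of f1) p; degrees 1 to 3 cancel by the choice
     of q1, q2, q3. *)
  set (h := fun z : C => (k * e3 + - (b1 * q3 + b2 * q2 + b3 * q1) + - (b2 * q3 + b3 * q2) * z
     + - (b3 * q3) * z ^ 2)%C).
  apply (near0_bounded_ext 4 (fun z => (z ^ 4 * h z + (r2 z * (k * z) + r1 z * (- (1) * p z))) * / f1 z)%C _ 1); [lra| |].
  - intros z Hz. unfold Q, r1, r2, h, p.
    assert (N := Nz z Hz). unfold q3, q2, q1. field. exact N.
  - apply (near0_bounded_mult 4 0 (fun z => (z ^ 4 * h z + (r2 z * (k * z) + r1 z * (- (1) * p z))))%C); [|exact I1].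
    apply near0_bounded_plus; [|apply near0_bounded_plus].
    + apply (near0_bounded_mult 4 0 (fun z => z ^ 4)%C); [apply near0_bounded_pow|unfold h; near0_poly].
    + apply (near0_bounded_mult 4 0 r2 (fun z => k * z)%C); [exact J2|near0_poly].
    + apply (near0_bounded_mult 4 0 r1 (fun z => - (1) * p z)%C); [exact J1|unfold p; near0_poly]. }
apply Csin_jet in JQ. destruct JQ as [M [d [Hd [_ HM]]]].
assert (Bes : Cmod q1 ^ 2 + Cmod q2 ^ 2 + Cmod (q3 - q1 ^ 3 / 6) ^ 2 <= 1).
{ apply (bessel_three_coefficients (fun z => Csin (Q z)) _ _ _ M d); [| |exact Hd|exact HM].
  - apply twice_differentiable_Csin. exact TQ.
  - intros z Hz. rewrite wQ by exact Hz. apply wb. exact Hz. }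
apply coefficient_inequality in Bes.
assert (pn : RtoC PI <> RtoC 0) by (intros X; apply RtoC_inj in X; lra).
assert (kE : k = (RtoC PI / 2)%C) by (unfold k; rewrite RtoC_div by lra; reflexivity).
assert (kn : k <> RtoC 0).
{ intros X. unfold k in X. apply RtoC_inj in X. lra. }
replace (a 2%nat * a 3%nat - a 4%nat)%C with
  (RtoC (- (1 / (6 * PI))) * ((q3 - q1 ^ 3 / 6) + RtoC (/ PI) * q1 * q2 + RtoC (/ 6 - 2 / PI ^ 2) * q1 ^ 3))%C.
- rewrite Cmod_mult, Cmod_R, Rabs_Ropp, Rabs_pos_eq.
  + rewrite <- (Rmult_1_r (1 / (6 * PI))) at 2. apply Rmult_le_compat_l; [|exact Bes].
    apply Rlt_le, Rdiv_lt_0_compat; lra.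
  + apply Rlt_le, Rdiv_lt_0_compat; lra.
(* In terms of k = PI / 2 every constant is rational, so the coefficient formula becomes a single
   field identity. *)
- replace (RtoC (- (1 / (6 * PI)))) with (- (1 / (12 * k)))%C.
  replace (RtoC (/ PI)) with (1 / (2 * k))%C.
  replace (RtoC (/ 6 - 2 / PI ^ 2)) with (1 / 6 - 1 / (2 * k * k))%C.
  + unfold q3, q2, q1, coef_derive. simpl INR. rewrite !RtoC_plus. field. exact kn.
  + rewrite kE. rewrite RtoC_minus, RtoC_div, RtoC_inv, RtoC_pow by (try apply pow_nonzero; lra). field. exact pn.
  + rewrite kE, RtoC_inv by lra. field. exact pn.
  + rewrite kE, RtoC_opp, RtoC_div, RtoC_mult by lra. field. exact pn.
Qed.

(** * Coefficients of the extremal function *)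

(* Coefficients of [(1 - z^6)^(-1/2)], the derivative of [arcsin (z^3)] up to the
   factor [3 z^2]; the recurrence is the coefficient form of
   [(1 - z^6) D' = 3 z^5 D]. *)
Fixpoint isqrt_coef (n : nat) : R :=
  match n with
  | S (S (S (S (S (S m))))) => isqrt_coef m * (INR m + 3) / (INR m + 6)
  | O => 1
  | _ => 0
  end.

Lemma isqrt_coef_step n : isqrt_coef (6 + n) = isqrt_coef n * (INR n + 3) / (INR n + 6).
Proof. reflexivity. Qed.

Lemma nat_ind6 (P : nat -> Prop) :
  P 0%nat -> P 1%nat -> P 2%nat -> P 3%nat -> P 4%nat -> P 5%nat ->
  (forall n, P n -> P (6 + n)%nat) -> forall n, P n.
Proof.
intros H0 H1 H2 H3 H4 H5 H n.
induction n as [n IH] using lt_wf_ind.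
do 6 (destruct n as [|n]; [assumption|]).
apply (H n). apply IH. lia.
Qed.

Lemma isqrt_coef_bounds n : 0 <= isqrt_coef n <= 1.
Proof.
induction n as [| | | | | |n IH] using nat_ind6; try (simpl; lra).
rewrite isqrt_coef_step. assert (Hn := pos_INR n).
assert (0 <= (INR n + 3) / (INR n + 6) <= 1).
{ split; [apply Rmult_le_pos; [lra|apply Rlt_le, Rinv_0_lt_compat; lra]|].
  apply (Rmult_le_reg_r (INR n + 6)); [lra|]. unfold Rdiv. rewrite Rmult_assoc, Rinv_l; lra. }
unfold Rdiv in *. rewrite Rmult_assoc. nra.
Qed.

(** The infinite sum is arcsin 1 = PI / 2; the weaker bound 2 has an elementary proof. [T N] is the
    window of the next six coefficients, the boundary term of a telescoping with step 6. *)
Lemma sum_isqrt_coef N :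
  sum_f_R0 (fun n => 3 * isqrt_coef n / (INR n + 3)) N <= 2.
Proof.
set (T := fun N => isqrt_coef (1 + N) + isqrt_coef (2 + N) + isqrt_coef (3 + N)
  + isqrt_coef (4 + N) + isqrt_coef (5 + N) + isqrt_coef (6 + N)).
(* telescoping, as [3 d_n / (n + 3) <= 2 (d_n - d_(n+6))] *)
assert (H : sum_f_R0 (fun n => 3 * isqrt_coef n / (INR n + 3)) N + 2 * T N <= 2).
{ induction N as [|N IH].
  - unfold T. simpl. lra.
  - rewrite tech5.
    assert (E : T (S N) = T N + isqrt_coef (6 + S N) - isqrt_coef (S N)).
    { unfold T. replace (1 + S N)%nat with (2 + N)%nat by lia. replace (2 + S N)%nat with (3 + N)%nat by lia.
      replace (3 + S N)%nat with (4 + N)%nat by lia. replace (4 + S N)%nat with (5 + N)%nat by lia.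
      replace (5 + S N)%nat with (6 + N)%nat by lia. replace (1 + N)%nat with (S N) by lia. ring. }
    rewrite E, isqrt_coef_step.
    assert (Hn := pos_INR N). rewrite S_INR.
    destruct (isqrt_coef_bounds (S N)) as [P _]. set (d := isqrt_coef (S N)) in *.
    assert (X : 3 * d / (INR N + 1 + 3) + 2 * (d * (INR N + 1 + 3) / (INR N + 1 + 6) - d) <= 0).
    { replace (3 * d / (INR N + 1 + 3) + 2 * (d * (INR N + 1 + 3) / (INR N + 1 + 6) - d))
        with (- (3 * d * (INR N + 1) / ((INR N + 1 + 3) * (INR N + 1 + 6)))) by (field; lra).
      assert (0 <= 3 * d * (INR N + 1) / ((INR N + 1 + 3) * (INR N + 1 + 6))); [|lra].
      apply Rmult_le_pos; [apply Rmult_le_pos; lra|].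
      apply Rlt_le, Rinv_0_lt_compat, Rmult_lt_0_compat; lra. }
    lra. }
assert (0 <= T N).
{ unfold T. assert (B := fun k => proj1 (isqrt_coef_bounds (k + N))).
  assert (B1 := B 1%nat). assert (B2 := B 2%nat). assert (B3 := B 3%nat).
  assert (B4 := B 4%nat). assert (B5 := B 5%nat). assert (B6 := B 6%nat). lra. }
lra.
Qed.

(** Termwise integral of 3 z^2 (1 - z^6)^(-1/2), hence the shift by three indices and the division
    by m + 3. *)
Definition arcsin_cube_coef (n : nat) : R :=
  match n with
  | S (S (S m)) => 3 * isqrt_coef m / (INR m + 3)
  | _ => 0
  end.

Lemma arcsin_cube_coef_pos n : 0 <= arcsin_cube_coef n.
Proof.
destruct n as [|[|[|n]]]; simpl; try lra.
assert (Hn := pos_INR n). destruct (isqrt_coef_bounds n) as [P _].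
apply Rmult_le_pos; [lra|apply Rlt_le, Rinv_0_lt_compat; lra].
Qed.

Lemma sum_arcsin_cube_coef N : sum_f_R0 arcsin_cube_coef N <= 2.
Proof.
destruct N as [|[|[|N]]]; try (simpl; lra).
enough (E : sum_f_R0 arcsin_cube_coef (S (S (S N))) = sum_f_R0 (fun n => 3 * isqrt_coef n / (INR n + 3)) N)
  by (rewrite E; apply sum_isqrt_coef).
induction N as [|N IH]; [simpl; lra|].
rewrite tech5, IH, (tech5 _ N). reflexivity.
Qed.

(** Coefficients of q = (2 / PI) arcsin (z^3), the right-hand factor in z g' = g q. *)
Definition q_coef (n : nat) : R := 2 / PI * arcsin_cube_coef n.

Lemma PI_gt_3 : 3 < PI.
Proof. assert (H := PI2_3_2). unfold PI2 in H. lra. Qed.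

Lemma q_coef_pos n : 0 <= q_coef n.
Proof.
assert (H := PI_gt_3). apply Rmult_le_pos; [|apply arcsin_cube_coef_pos].
apply Rlt_le, Rdiv_lt_0_compat; lra.
Qed.

Lemma sum_q_coef N : sum_f_R0 q_coef N <= 4 / 3.
Proof.
assert (H := PI_gt_3). assert (B := sum_arcsin_cube_coef N).
assert (I : 0 < / PI <= / 3).
{ split; [apply Rinv_0_lt_compat; lra|apply Rinv_le_contravar; lra]. }
rewrite (sum_eq q_coef (fun n => arcsin_cube_coef n * (2 / PI)) N)
  by (intros i _; unfold q_coef; ring).
rewrite <- scal_sum.
assert (0 <= sum_f_R0 arcsin_cube_coef N) by (apply cond_pos_sum, arcsin_cube_coef_pos).
unfold Rdiv. nra.
Qed.

(* Table of the solution of [n g_n = sum_(k < n) g_k q_(n-k)], [g_0 = 1], the coefficient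
   form of [z g' = g q]; row [n] is correct up to index [n]. *)
Fixpoint g_table (n : nat) : nat -> R :=
  match n with
  | O => fun _ => 1
  | S m => fun k => if Nat.leb k m then g_table m k
                    else sum_f_R0 (fun i => g_table m i * q_coef (S m - i)) m / INR (S m)
  end.

Definition g_coef (n : nat) : R := g_table n n.

Lemma g_table_stable n k : (k <= n)%nat -> g_table n k = g_coef k.
Proof.
induction n as [|n IH]; intros H.
- replace k with 0%nat by lia. reflexivity.
- destruct (Nat.eq_dec k (S n)) as [->|N]; [reflexivity|].
  simpl. rewrite (proj2 (Nat.leb_le k n)) by lia. apply IH. lia.
Qed.

Lemma g_coef_S m : g_coef (S m) = sum_f_R0 (fun i => g_coef i * q_coef (S m - i)) m / INR (S m).
Proof.
unfold g_coef at 1. cbn [g_table]. rewrite (proj2 (Nat.leb_gt (S m) m)) by lia.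
f_equal. apply sum_eq. intros i Hi. now rewrite g_table_stable.
Qed.

(** As [q_coef 0] vanishes, the recurrence may include k = n and becomes a full Cauchy product. *)
Lemma g_coef_convolution n : INR n * g_coef n = sum_f_R0 (fun k => g_coef k * q_coef (n - k)) n.
Proof.
assert (Q0 : q_coef 0 = 0) by (unfold q_coef; simpl; ring).
destruct n as [|m].
- simpl. rewrite Q0. ring.
- rewrite tech5, Nat.sub_diag, Q0, g_coef_S. field. apply not_0_INR. lia.
Qed.

Lemma g_coef_pos n : 0 <= g_coef n.
Proof.
induction n as [n IH] using lt_wf_ind. destruct n as [|m].
- unfold g_coef; simpl; lra.
- rewrite g_coef_S. apply Rmult_le_pos; [|apply Rlt_le, Rinv_0_lt_compat, lt_0_INR; lia].
  assert (G : forall N, (N <= m)%nat -> 0 <= sum_f_R0 (fun i => g_coef i * q_coef (S m - i)) N).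
  { induction N as [|N IHN]; intros HN.
    - simpl. apply Rmult_le_pos; [apply IH; lia|apply q_coef_pos].
    - rewrite tech5. apply Rplus_le_le_0_compat; [apply IHN; lia|].
      apply Rmult_le_pos; [apply IH; lia|apply q_coef_pos]. }
  apply G. lia.
Qed.

Lemma g_coef_0 : g_coef 0 = 1. Proof. reflexivity. Qed.

Lemma g_coef_1 : g_coef 1 = 0.
Proof. rewrite g_coef_S. unfold q_coef; simpl. field. apply PI_neq0. Qed.

Lemma g_coef_2 : g_coef 2 = 0.
Proof. rewrite g_coef_S. simpl sum_f_R0. rewrite g_coef_1. unfold q_coef; simpl. field. apply PI_neq0. Qed.

Lemma g_coef_3 : g_coef 3 = 2 / (3 * PI).
Proof.
rewrite g_coef_S. simpl sum_f_R0. rewrite g_coef_1, g_coef_2, g_coef_0.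
unfold q_coef; simpl. field. apply PI_neq0.
Qed.

Lemma sum_convolution (u v : nat -> R) N :
  sum_f_R0 (fun n => sum_f_R0 (fun k => u k * v (n - k)%nat) n) N
  = sum_f_R0 (fun k => u k * sum_f_R0 v (N - k)) N.
Proof.
induction N as [|N IH]; [reflexivity|].
rewrite !tech5, IH, Nat.sub_diag.
rewrite (sum_eq (fun k => u k * sum_f_R0 v (S N - k)) (fun k => u k * sum_f_R0 v (N - k) + u k * v (S N - k)%nat)).
- rewrite sum_plus. simpl sum_f_R0. ring.
- intros i Hi. rewrite Nat.sub_succ_l by exact Hi. rewrite tech5. ring.
Qed.

(** Let S be the partial sum. Since g_1 = g_2 = 0, the sum of n g_n is at least 3 (S - 1); by the
    convolution identity it is at most (4 / 3) S. Hence (5 / 3) S <= 3. The argument is finite and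
    closes because 4 / 3 < 3. *)
Lemma sum_g_coef N : sum_f_R0 g_coef N <= 9 / 5.
Proof.
assert (A : 3 * (sum_f_R0 g_coef N - 1) <= sum_f_R0 (fun n => INR n * g_coef n) N).
{ induction N as [|N IH]; [simpl; rewrite g_coef_0; lra|].
  rewrite !tech5.
  enough (3 * g_coef (S N) <= INR (S N) * g_coef (S N)) by lra.
  destruct N as [|[|N]].
  - rewrite g_coef_1. lra.
  - rewrite g_coef_2. lra.
  - apply Rmult_le_compat_r; [apply g_coef_pos|]. rewrite !S_INR. assert (Hn := pos_INR N). lra. }
assert (B : sum_f_R0 (fun n => INR n * g_coef n) N <= 4 / 3 * sum_f_R0 g_coef N).
{ rewrite (sum_eq _ _ N (fun n _ => g_coef_convolution n)), sum_convolution, scal_sum.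
  apply sum_Rle. intros k _.
  apply Rmult_le_compat_l; [apply g_coef_pos|apply sum_q_coef]. }
lra.
Qed.

Lemma is_series_of_bounded_sums (u : nat -> R) M :
  (forall n, 0 <= u n) -> (forall N, sum_f_R0 u N <= M) -> exists l : R, is_series u l /\ l <= M.
Proof.
intros Hu HM.
destruct (ex_finite_lim_seq_incr (sum_n u) M) as [l Hl].
- intros n. rewrite sum_Sn. unfold plus; simpl. specialize (Hu (S n)). lra.
- intros n. rewrite sum_n_Reals. apply HM.
- exists l. split; [exact Hl|].
  apply (is_lim_seq_le (sum_n u) (fun _ => M) l M); [|exact Hl|apply is_lim_seq_const].
  intros n. rewrite sum_n_Reals. apply HM.
Qed.

Lemma RtoC_power_series (u : nat -> R) M :
  (forall n, 0 <= u n) -> (forall N, sum_f_R0 u N <= M) ->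
  power_series (fun n => RtoC (u n)) (power_sum (fun n => RtoC (u n))).
Proof.
intros Hu HM. apply power_series_of_abs. intros r Hr.
destruct (is_series_of_bounded_sums u M Hu HM) as [l [Hl _]].
apply (ex_series_le (K:=R_AbsRing) (V:=R_CompleteNormedModule) _ u); [|exists l; exact Hl].
intros n. change (Rabs (Cmod (RtoC (u n)) * r ^ n) <= u n).
assert (P : 0 <= r ^ n) by (apply pow_le; lra).
assert (P1 : r ^ n <= 1) by (rewrite <- (pow1 n); apply pow_incr; lra).
rewrite Cmod_R, (Rabs_pos_eq (u n)) by apply Hu. specialize (Hu n).
rewrite Rabs_pos_eq by (apply Rmult_le_pos; lra). nra.
Qed.

(** * The arcsine of the cube *)

(** Real and imaginary parts reduce this to four real Cauchy products. *)
Lemma cseries_mult (u v : nat -> C) (a b : C) :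
  cseries u a -> cseries v b ->
  ex_series (fun n => Cmod (u n)) -> ex_series (fun n => Cmod (v n)) ->
  cseries (fun n => sum_n (G:=C_AbelianMonoid) (fun k => (u k * v (n - k)%nat)%C) n) (a * b)%C.
Proof.
intros Hu Hv Au Av. apply cseries_Re_Im in Hu as [U1 U2]. apply cseries_Re_Im in Hv as [V1 V2].
assert (AR : forall w : nat -> C, ex_series (fun n => Cmod (w n)) -> ex_series (fun n => Rabs (Re (w n)))).
{ intros w H. apply (ex_series_le (K:=R_AbsRing) (V:=R_CompleteNormedModule) _ (fun n => Cmod (w n))); [|exact H].
  intros n. change (Rabs (Rabs (Re (w n))) <= Cmod (w n)). rewrite Rabs_Rabsolu. apply re_le_Cmod. }
assert (AI : forall w : nat -> C, ex_series (fun n => Cmod (w n)) -> ex_series (fun n => Rabs (Im (w n)))).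
{ intros w H. apply (ex_series_le (K:=R_AbsRing) (V:=R_CompleteNormedModule) _ (fun n => Cmod (w n))); [|exact H].
  intros n. change (Rabs (Rabs (Im (w n))) <= Cmod (w n)). rewrite Rabs_Rabsolu. apply Rabs_snd_le_Cmod. }
assert (P1 := is_series_mult _ _ _ _ U1 V1 (AR _ Au) (AR _ Av)).
assert (P2 := is_series_mult _ _ _ _ U2 V2 (AI _ Au) (AI _ Av)).
assert (P3 := is_series_mult _ _ _ _ U1 V2 (AR _ Au) (AI _ Av)).
assert (P4 := is_series_mult _ _ _ _ U2 V1 (AI _ Au) (AR _ Av)).
apply cseries_Re_Im. split.
- refine (is_series_ext _ _ _ _ (is_series_minus (K:=R_AbsRing) (V:=R_NormedModule) _ _ _ _ P1 P2)).
  intros n. rewrite sum_n_Re, sum_n_Reals.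
  change (sum_f_R0 (fun k => Re (u k) * Re (v (n - k)%nat)) n - sum_f_R0 (fun k => Im (u k) * Im (v (n - k)%nat)) n
    = sum_f_R0 (fun k => Re (u k * v (n - k)%nat)) n).
  rewrite <- minus_sum. apply sum_eq. intros i _. reflexivity.
- refine (is_series_ext _ _ _ _ (is_series_plus (K:=R_AbsRing) (V:=R_NormedModule) _ _ _ _ P3 P4)).
  intros n. rewrite sum_n_Im, sum_n_Reals.
  change (sum_f_R0 (fun k => Re (u k) * Im (v (n - k)%nat)) n + sum_f_R0 (fun k => Im (u k) * Re (v (n - k)%nat)) n
    = sum_f_R0 (fun k => Im (u k * v (n - k)%nat)) n).
  rewrite <- sum_plus. apply sum_eq. intros i _. reflexivity.
Qed.

Lemma power_series_abs a f z : power_series a f -> Cmod z < 1 -> ex_series (fun n => Cmod (a n * z ^ n)%C).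
Proof.
intros H Hz.
apply (ex_series_ext (fun n => Cmod (a n) * Cmod z ^ n)).
- intros n. now rewrite Cmod_mult, Cmod_pow.
- apply ex_series_radius. apply (power_series_radius a f); [exact H|]. split; [apply Cmod_ge_0|exact Hz].
Qed.

Lemma cseries_euler a f z : power_series a f -> Cmod z < 1 ->
  cseries (fun n => RtoC (INR n) * a n * z ^ n)%C (z * power_sum (coef_derive a) z)%C.
Proof.
intros H Hz. destruct (power_series_derive a f H) as [P _].
refine (proj1 (cseries_shift (fun n => RtoC (INR n) * a n * z ^ n)%C (z * power_sum (coef_derive a) z)%C) _).
replace (z * power_sum (coef_derive a) z - RtoC (INR 0) * a 0%nat * z ^ 0)%C
  with (z * power_sum (coef_derive a) z)%C by (simpl; ring).
refine (cseries_ext _ _ _ _ (cseries_scal z _ _ (P z Hz))).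
intros n. unfold coef_derive. simpl Cpow. ring.
Qed.

Lemma constant_of_zero_derivative (F : C -> C) :
  (forall z, Cmod z < 1 -> cder F z (RtoC 0)) -> forall z, Cmod z < 1 -> F z = F (RtoC 0).
Proof.
intros D z Hz.
assert (Q := mean_value_ineq F (fun _ => RtoC 0) (RtoC 0) z 0).
assert (X : Cmod (F z - F (RtoC 0)) <= 0).
{ eapply Rle_trans; [|apply Req_le, (Rmult_0_l (Cmod (z - RtoC 0)))]. apply Q. intros t Ht.
  split; [|rewrite Cmod_0; lra]. apply D. rewrite Cminus_0_r, Cplus_0_l, Cmod_mult, Cmod_R, Rabs_pos_eq by lra.
  assert (G := Cmod_ge_0 z). nra. }
assert (Y : (F z - F (RtoC 0))%C = RtoC 0).
{ apply Cmod_eq_0. assert (G := Cmod_ge_0 (F z - F (RtoC 0))). lra. }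
replace (F z) with ((F z - F (RtoC 0)) + F (RtoC 0))%C by ring. rewrite Y. ring.
Qed.

Definition isqrt_sum : C -> C := power_sum (fun n => RtoC (isqrt_coef n)).

Lemma power_series_isqrt : power_series (fun n => RtoC (isqrt_coef n)) isqrt_sum.
Proof.
apply power_series_of_abs. intros r Hr.
apply (ex_series_le (K:=R_AbsRing) (V:=R_CompleteNormedModule) _ (fun n => r ^ n)).
- intros n. change (Rabs (Cmod (RtoC (isqrt_coef n)) * r ^ n) <= r ^ n).
  assert (P : 0 <= r ^ n) by (apply pow_le; lra). assert (B := isqrt_coef_bounds n).
  rewrite Cmod_R, (Rabs_pos_eq (isqrt_coef n)) by lra.
  rewrite Rabs_pos_eq by (apply Rmult_le_pos; lra). nra.
- eexists. apply is_series_geom. rewrite Rabs_pos_eq; lra.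
Qed.

Definition isqrt_sum' : C -> C := power_sum (coef_derive (fun n => RtoC (isqrt_coef n))).

Lemma cder_isqrt_sum z : Cmod z < 1 -> cder isqrt_sum z (isqrt_sum' z).
Proof. apply (power_series_derive _ _ power_series_isqrt). Qed.

(** The coefficients of D' below index 5 vanish, and the one of index n + 5 is (n + 6) d_(n+6) = (n
    + 3) d_n; so D' = z^5 (3 D + z D'). *)
Lemma isqrt_sum_ode z : Cmod z < 1 ->
  ((1 - z ^ 6) * isqrt_sum' z)%C = (3 * z ^ 5 * isqrt_sum z)%C.
Proof.
intros Hz.
destruct (power_series_derive _ _ power_series_isqrt) as [P _]. fold isqrt_sum' in P.
assert (S1 := P z Hz). do 5 apply cseries_shift in S1.
assert (S2 := cseries_euler _ _ z power_series_isqrt Hz). fold isqrt_sum' in S2.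
assert (S3 := cseries_scal 3 _ _ (power_series_isqrt z Hz)).
assert (S4 := cseries_scal (z ^ 5)%C _ _ (cseries_plus _ _ _ _ S3 S2)).
apply cseries_ext with (v := fun n => (coef_derive (fun n => RtoC (isqrt_coef n)) (5 + n) * z ^ (5 + n))%C) in S4.
- assert (E := cseries_unique _ _ _ S1 S4). unfold coef_derive in E. simpl isqrt_coef in E.
  replace ((1 - z ^ 6) * isqrt_sum' z)%C with (isqrt_sum' z - z ^ 6 * isqrt_sum' z)%C by ring.
  replace (isqrt_sum' z) with (z ^ 5 * (3 * isqrt_sum z + z * isqrt_sum' z))%C at 1.
  + ring.
  + rewrite <- E. ring.
- intros n. unfold coef_derive. rewrite Cpow_add_r.
  change (S (5 + n)) with (6 + n)%nat. rewrite isqrt_coef_step, plus_INR.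
  assert (Hn := pos_INR n).
  replace (RtoC (INR 6 + INR n) * RtoC (isqrt_coef n * (INR n + 3) / (INR n + 6)))%C
    with (RtoC (isqrt_coef n) * (3 + RtoC (INR n)))%C.
  + ring.
  + rewrite <- RtoC_plus, <- !RtoC_mult. f_equal. simpl (INR 6). field. lra.
Qed.

Lemma isqrt_sum_0 : isqrt_sum (RtoC 0) = RtoC 1.
Proof. rewrite (power_series_0 _ _ power_series_isqrt). reflexivity. Qed.

Lemma cder_one_minus_pow6 z : cder (fun z => 1 - z ^ 6)%C z (- (6 * z ^ 5))%C.
Proof.
eapply cder_eq. apply cder_minus. apply cder_const. apply (cder_pow 5).
simpl INR. rewrite !RtoC_plus. ring.
Qed.

(** By the differential equation the left side has derivative 0, and it is 1 at the origin. This
    identifies the series as an inverse square root without choosing a branch. *)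
Lemma isqrt_sum_square z : Cmod z < 1 ->
  ((1 - z ^ 6) * (isqrt_sum z * isqrt_sum z))%C = RtoC 1.
Proof.
intros Hz.
rewrite (constant_of_zero_derivative (fun z => (1 - z ^ 6) * (isqrt_sum z * isqrt_sum z))%C); [| |exact Hz].
- rewrite isqrt_sum_0. simpl. ring.
- clear z Hz. intros z Hz. eapply cder_eq.
  apply (cder_mult (fun z => 1 - z ^ 6)%C). apply cder_one_minus_pow6.
  apply cder_mult; apply cder_isqrt_sum; exact Hz.
  cbv beta.
  replace (- (6 * z ^ 5) * (isqrt_sum z * isqrt_sum z) + (1 - z ^ 6) * (isqrt_sum' z * isqrt_sum z + isqrt_sum z * isqrt_sum' z))%C
   with (- (6 * z ^ 5) * (isqrt_sum z * isqrt_sum z) + 2 * isqrt_sum z * ((1 - z ^ 6) * isqrt_sum' z))%C by ring.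
  rewrite isqrt_sum_ode by exact Hz. ring.
Qed.

Definition arcsin_cube : C -> C := power_sum (fun n => RtoC (arcsin_cube_coef n)).

Lemma power_series_arcsin_cube : power_series (fun n => RtoC (arcsin_cube_coef n)) arcsin_cube.
Proof. exact (RtoC_power_series _ _ arcsin_cube_coef_pos sum_arcsin_cube_coef). Qed.

Lemma arcsin_cube_0 : arcsin_cube (RtoC 0) = RtoC 0.
Proof. rewrite (power_series_0 _ _ power_series_arcsin_cube). reflexivity. Qed.

Lemma cder_arcsin_cube z : Cmod z < 1 -> cder arcsin_cube z (3 * z ^ 2 * isqrt_sum z)%C.
Proof.
intros Hz. destruct (power_series_derive _ _ power_series_arcsin_cube) as [P D].
eapply cder_eq; [apply D; exact Hz|].
assert (S1 := P z Hz). do 2 apply cseries_shift in S1.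
assert (S2 := cseries_scal (3 * z ^ 2)%C _ _ (power_series_isqrt z Hz)).
apply cseries_ext with (v := fun n => (coef_derive (fun n => RtoC (arcsin_cube_coef n)) (2 + n) * z ^ (2 + n))%C) in S2.
- rewrite <- (cseries_unique _ _ _ S1 S2). unfold coef_derive. simpl. ring.
- intros n. unfold coef_derive. rewrite Cpow_add_r.
  change (arcsin_cube_coef (S (2 + n))) with (3 * isqrt_coef n / (INR n + 3)).
  assert (Hn := pos_INR n).
  replace (RtoC (INR (S (2 + n))) * RtoC (3 * isqrt_coef n / (INR n + 3)))%C with (3 * RtoC (isqrt_coef n))%C.
  + ring.
  + rewrite <- !RtoC_mult. f_equal. rewrite S_INR, plus_INR. simpl (INR 2). field. lra.
Qed.

(** Euler's formula exp (c A) = c sin A + cos A for c = i and c = -i at once, with (1 - z^6) D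
    standing for the square root of 1 - z^6. The right side times exp (- c A) is shown to be
    constant. *)
Lemma Cexp_arcsin_cube c z : (c * c = - (1))%C -> Cmod z < 1 ->
  Cexp (c * arcsin_cube z) = (c * z ^ 3 + (1 - z ^ 6) * isqrt_sum z)%C.
Proof.
intros Hc Hz.
set (F := fun z => ((c * z ^ 3 + (1 - z ^ 6) * isqrt_sum z) * Cexp (- c * arcsin_cube z))%C).
assert (E : F z = RtoC 1).
{ rewrite (constant_of_zero_derivative F); [| |exact Hz].
  - unfold F. rewrite arcsin_cube_0, isqrt_sum_0. replace (- c * 0)%C with (RtoC 0) by ring.
    rewrite Cexp_0. simpl. ring.
  - clear z Hz. intros z Hz. unfold F. eapply cder_eq.
    apply (cder_mult (fun z => c * z ^ 3 + (1 - z ^ 6) * isqrt_sum z)%C (fun z => Cexp (- c * arcsin_cube z))).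
    apply cder_plus. apply cder_scal. apply (cder_pow 2).
    apply (cder_mult (fun z => 1 - z ^ 6)%C). apply cder_one_minus_pow6. apply cder_isqrt_sum; exact Hz.
    apply (cder_comp Cexp (fun z => - c * arcsin_cube z)%C). apply cder_Cexp.
    apply cder_scal. apply cder_arcsin_cube. exact Hz.
    cbv beta. rewrite isqrt_sum_ode by exact Hz.
    simpl INR. rewrite !RtoC_plus.
    set (e := Cexp (- c * arcsin_cube z)). assert (Q := isqrt_sum_square z Hz).
    set (d := isqrt_sum z) in *.
    (* The derivative is grouped so that one factor vanishes by (1 - z^6) d^2 = 1 and the other by
       c^2 = -1. *)
    transitivity (e * (3 * c * z ^ 2 * (1 - (1 - z ^ 6) * (d * d)) - 3 * z ^ 5 * d * (1 + c * c)))%C; [ring|].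
    rewrite Q, Hc. ring. }
unfold F in E. set (K := (c * z ^ 3 + (1 - z ^ 6) * isqrt_sum z)%C) in *.
transitivity (Cexp (c * arcsin_cube z) * (K * Cexp (- c * arcsin_cube z)))%C; [rewrite E; ring|].
replace (- c * arcsin_cube z)%C with (- (c * arcsin_cube z))%C by ring.
transitivity (K * (Cexp (c * arcsin_cube z) * Cexp (- (c * arcsin_cube z))))%C; [ring|].
rewrite Cexp_opp. ring.
Qed.

Lemma Csin_arcsin_cube z : Cmod z < 1 -> Csin (arcsin_cube z) = (z ^ 3)%C.
Proof.
intros Hz. assert (H1 := Cexp_arcsin_cube Ci z Ci2 Hz).
assert (H2 : Cexp (- Ci * arcsin_cube z) = (- Ci * z ^ 3 + (1 - z ^ 6) * isqrt_sum z)%C).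
{ apply Cexp_arcsin_cube; [|exact Hz]. rewrite <- Ci2. ring. }
unfold Csin. replace (- (Ci * arcsin_cube z))%C with (- Ci * arcsin_cube z)%C by ring.
rewrite H1, H2. field. apply Ci_neq_0.
Qed.

Lemma Re_Csin u : Re (Csin u) = sin (Re u) * ((exp (Im u) + exp (- Im u)) / 2).
Proof.
assert (H2 := C2_neq_0). assert (Hi := Ci_neq_0).
replace (Csin u) with (RtoC (- / 2) * (Ci * (Cexp (Ci * u) - Cexp (- (Ci * u)))))%C.
- destruct u as [x y]. unfold Cexp, Ci, Cminus, Cplus, Copp, Cmult, RtoC, Re, Im; simpl.
  replace (- (0 * x - 1 * y)) with y by ring. replace (0 * x - 1 * y) with (- y) by ring.
  replace (- (0 * y + 1 * x)) with (- x) by ring. replace (0 * y + 1 * x) with x by ring.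
  rewrite sin_neg. field.
- unfold Csin. rewrite RtoC_opp, RtoC_inv by lra.
  transitivity ((Ci * Ci) * - / 2 * ((Cexp (Ci * u) - Cexp (- (Ci * u))) / Ci))%C; [field; auto|].
  rewrite Ci2. field. auto.
Qed.

(* [|sin u| >= 1] on the lines [Re u = PI/2] and [Re u = - PI/2], so the image of a radius
   cannot leave the strip between them. *)
Lemma arcsin_cube_strip z : Cmod z < 1 -> - (PI / 2) < Re (arcsin_cube z) < PI / 2.
Proof.
intros Hz. assert (HPI := PI_RGT_0).
set (c := fun t : R => (RtoC 0 + RtoC t * z)%C).
assert (Dom : forall t, 0 <= t <= 1 -> Cmod (c t) < 1).
{ intros t Ht. unfold c. rewrite Cplus_0_l, Cmod_mult, Cmod_R, Rabs_pos_eq by lra.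
  assert (G := Cmod_ge_0 z). nra. }
assert (Big : forall t, 0 <= t <= 1 -> Rabs (sin (Re (arcsin_cube (c t)))) <> 1).
{ intros t Ht E. assert (B := Dom t Ht).
  assert (L := re_le_Cmod (Csin (arcsin_cube (c t)))).
  rewrite Re_Csin, Rabs_mult, E, Rmult_1_l, Csin_arcsin_cube, Cmod_pow in L by exact B.
  set (y := Im (arcsin_cube (c t))) in *.
  assert (E1 := exp_pos y). assert (E2 : exp y * exp (- y) = 1).
  { rewrite <- exp_plus, Rplus_opp_r. apply exp_0. }
  assert (E3 := exp_pos (- y)).
  assert (2 <= exp y + exp (- y)) by (assert (Q := pow2_ge_0 (exp y - exp (- y))); nra).
  rewrite Rabs_pos_eq in L by lra.
  assert (G := Cmod_ge_0 (c t)). assert (Cmod (c t) ^ 3 < 1) by (simpl; nra). lra. }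
(* The sign s = 1 or s = -1 treats both boundary lines; a crossing would give, by the intermediate
   value theorem, a point on the radius excluded by [Big]. *)
assert (K : forall s, s * s = 1 -> s * Re (arcsin_cube z) < PI / 2).
{ intros s Hs. destruct (Rlt_le_dec (s * Re (arcsin_cube z)) (PI / 2)) as [H|H]; [exact H|exfalso].
  set (h := fun t => s * Re (arcsin_cube (c t)) - PI / 2).
  assert (c0 : c 0 = RtoC 0) by (unfold c; ring). assert (c1 : c 1 = z) by (unfold c; ring).
  assert (Ss : forall t, s * Re (arcsin_cube (c t)) = PI / 2 -> Rabs (sin (Re (arcsin_cube (c t)))) = 1).
  { intros t E. assert (X : (s - 1) * (s + 1) = 0) by (ring_simplify; nra).
    apply Rmult_integral in X. destruct X as [X|X].
    - replace (Re (arcsin_cube (c t))) with (PI / 2) by (rewrite <- E; replace s with 1 by lra; ring).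
      rewrite sin_PI2. apply Rabs_R1.
    - replace (Re (arcsin_cube (c t))) with (- (PI / 2)) by (rewrite <- E; replace s with (-1) by lra; ring).
      rewrite sin_neg, sin_PI2, Rabs_Ropp. apply Rabs_R1. }
  destruct (Req_dec (s * Re (arcsin_cube z)) (PI / 2)) as [E|NE].
  - apply (Big 1); [lra|]. apply Ss. rewrite c1. exact E.
  - destruct (IVT_interv h 0 1) as [t [Ht E]].
    + intros t Ht. apply continuity_pt_filterlim.
      apply (ex_derive_continuous (K:=R_AbsRing) (V:=R_NormedModule)).
      assert (D : is_derive (fun t => Re (arcsin_cube (c t))) t (Re (z * (3 * c t ^ 2 * isqrt_sum (c t))))).
      { apply curve_der_Re. apply curve_der_comp. apply cder_arcsin_cube. apply Dom; lra. apply curve_der_segment. }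
      eexists.
      exact (is_derive_minus (K:=R_AbsRing) (V:=R_NormedModule) _ _ t _ _
        (is_derive_scal _ t s _ D) (is_derive_const (K:=R_AbsRing) (V:=R_NormedModule) (PI / 2) t)).
    + lra.
    + unfold h. rewrite c0, arcsin_cube_0. simpl. lra.
    + unfold h. rewrite c1. lra.
    + apply (Big t Ht). apply Ss. unfold h in E. lra. }
assert (K1 := K 1 ltac:(ring)). assert (K2 := K (-1) ltac:(ring)). lra.
Qed.

Lemma arcsin_cube_Carcsin z : Cmod z < 1 -> arcsin_cube z = Carcsin (z ^ 3)%C.
Proof.
intros Hz. rewrite <- Csin_arcsin_cube by exact Hz. symmetry.
apply Carcsin_Csin. apply arcsin_cube_strip. exact Hz.
Qed.

(** * The extremal function *)

Definition g_sum : C -> C := power_sum (fun n => RtoC (g_coef n)).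
Definition g_sum' : C -> C := power_sum (coef_derive (fun n => RtoC (g_coef n))).

Lemma power_series_g : power_series (fun n => RtoC (g_coef n)) g_sum.
Proof. exact (RtoC_power_series _ _ g_coef_pos sum_g_coef). Qed.

(** Once the principal value is replaced by its series, the two sides have equal coefficients by
    [g_coef_convolution]. *)
Lemma g_sum_ode z : Cmod z < 1 -> (z * g_sum' z)%C = (g_sum z * (RtoC (2 / PI) * Carcsin (z ^ 3)))%C.
Proof.
intros Hz. rewrite <- arcsin_cube_Carcsin by exact Hz.
assert (S1 := cseries_euler _ _ z power_series_g Hz). fold g_sum' in S1.
assert (Pq : power_series (fun n => RtoC (q_coef n)) (fun z => RtoC (2 / PI) * arcsin_cube z)%C).
{ intros y Hy. refine (cseries_ext _ _ _ _ (cseries_scal (RtoC (2 / PI)) _ _ (power_series_arcsin_cube y Hy))).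
  intros n. unfold q_coef. rewrite RtoC_mult. ring. }
assert (S2 := cseries_mult _ _ _ _ (power_series_g z Hz) (Pq z Hz)
  (power_series_abs _ _ z power_series_g Hz) (power_series_abs _ _ z Pq Hz)).
refine (cseries_unique _ _ _ S1 (cseries_ext _ _ _ _ S2)).
intros n. rewrite <- RtoC_mult, g_coef_convolution.
assert (G : forall N, (N <= n)%nat ->
  sum_n (G:=C_AbelianMonoid) (fun k => (RtoC (g_coef k) * z ^ k * (RtoC (q_coef (n - k)) * z ^ (n - k)))%C) N
  = (RtoC (sum_f_R0 (fun k => (g_coef k * q_coef (n - k))%R) N) * z ^ n)%C).
{ assert (T : forall k, (k <= n)%nat -> (RtoC (g_coef k) * z ^ k * (RtoC (q_coef (n - k)) * z ^ (n - k)))%C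
     = (RtoC (g_coef k * q_coef (n - k))%R * z ^ n)%C).
  { intros k Hk. replace (z ^ n)%C with (z ^ k * z ^ (n - k))%C
      by (rewrite <- Cpow_add_r; f_equal; lia). rewrite RtoC_mult. ring. }
  induction N as [|N IH]; intros HN.
  - rewrite sum_O. apply T. exact HN.
  - rewrite sum_Sn, IH by lia. rewrite tech5, RtoC_plus, Cmult_plus_distr_r, <- T by exact HN.
    reflexivity. }
apply G. lia.
Qed.

Lemma g_sum_near_1 z : Cmod z < 1 -> Cmod (g_sum z - 1) <= 4 / 5.
Proof.
intros Hz.
destruct (is_series_of_bounded_sums g_coef (9 / 5) g_coef_pos sum_g_coef) as [l [Hl Bl]].
assert (Hl' : is_series (fun n => g_coef (S n)) (l - 1)).
{ apply (is_series_incr_1 (K:=R_AbsRing) (V:=R_NormedModule)).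
  refine (eq_rect _ (fun m => is_series g_coef m) Hl _ _).
  change (l = l - 1 + g_coef 0). rewrite g_coef_0. ring. }
assert (S1 := power_series_g z Hz). apply cseries_shift in S1.
replace (g_sum z - 1)%C with (g_sum z - RtoC (g_coef 0) * z ^ 0)%C by (rewrite g_coef_0; simpl; ring).
apply Rle_trans with (l - 1); [|lra].
refine (cseries_norm_le _ _ _ _ S1 Hl' _).
intros n. rewrite Cmod_mult, Cmod_pow, Cmod_R, Rabs_pos_eq by apply g_coef_pos.
assert (G0 := Cmod_ge_0 z). assert (G := g_coef_pos (S n)).
assert (P : 0 <= Cmod z ^ S n) by (apply pow_le; lra).
assert (Cmod z ^ S n <= 1) by (rewrite <- (pow1 (S n)); apply pow_incr; lra).
nra.
Qed.

Lemma g_sum_neq_0 z : Cmod z < 1 -> g_sum z <> RtoC 0.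
Proof.
intros Hz E. assert (B := g_sum_near_1 z Hz). rewrite E in B.
replace (RtoC 0 - 1)%C with (- (1))%C in B by ring. rewrite Cmod_opp, Cmod_1 in B. lra.
Qed.

Definition extremal_coef (n : nat) : C :=
  match n with
  | O => RtoC 0
  | S m => RtoC (g_coef m / INR (S m))
  end.

Definition extremal : C -> C := power_sum extremal_coef.

Lemma coef_derive_extremal : coef_derive extremal_coef = (fun n => RtoC (g_coef n)).
Proof.
apply functional_extensionality. intros n. unfold coef_derive, extremal_coef.
rewrite <- RtoC_mult. f_equal. field. apply not_0_INR. lia.
Qed.

Lemma power_series_extremal : power_series extremal_coef extremal.
Proof.
apply power_series_of_abs. intros r Hr.
apply ex_series_incr_1.
destruct (is_series_of_bounded_sums g_coef (9 / 5) g_coef_pos sum_g_coef) as [l [Hl _]].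
apply (ex_series_le (K:=R_AbsRing) (V:=R_CompleteNormedModule) _ g_coef); [|exists l; exact Hl].
intros n. change (Rabs (Cmod (RtoC (g_coef n / INR (S n))) * r ^ S n) <= g_coef n).
assert (P : 0 <= r ^ S n) by (apply pow_le; lra).
assert (P1 : r ^ S n <= 1) by (rewrite <- (pow1 (S n)); apply pow_incr; lra).
assert (G := g_coef_pos n).
assert (I : 0 < / INR (S n) <= 1).
{ rewrite S_INR. assert (Hn := pos_INR n). split; [apply Rinv_0_lt_compat; lra|].
  rewrite <- Rinv_1. apply Rinv_le_contravar; lra. }
assert (D : 0 <= g_coef n / INR (S n) <= g_coef n) by (unfold Rdiv; nra).
rewrite Cmod_R, (Rabs_pos_eq (_ / _)) by lra. rewrite Rabs_pos_eq by (apply Rmult_le_pos; lra).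
nra.
Qed.

Lemma cder_extremal z : Cmod z < 1 -> cder extremal z (g_sum z).
Proof.
intros Hz. destruct (power_series_derive _ _ power_series_extremal) as [_ D].
rewrite coef_derive_extremal in D. apply D. exact Hz.
Qed.

(** On the convex disc f(z) - z has Lipschitz constant 4 / 5 < 1, so f (z1) = f (z2) forces |z2 -
    z1| <= (4 / 5) |z2 - z1|. *)
Lemma extremal_univalent : univalent_on_disc extremal.
Proof.
intros z1 z2 H1 H2 E. unfold unit_disc in H1, H2.
assert (B : Cmod ((extremal z2 - z2) - (extremal z1 - z1)) <= 4 / 5 * Cmod (z2 - z1)).
{ apply (mean_value_ineq (fun z => extremal z - z)%C (fun z => g_sum z - 1)%C z1 z2).
  intros t Ht.
  assert (Dom : Cmod (z1 + RtoC t * (z2 - z1)) < 1).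
  { replace (z1 + RtoC t * (z2 - z1))%C with (RtoC (1 - t) * z1 + RtoC t * z2)%C by (rewrite RtoC_minus; ring).
    eapply Rle_lt_trans; [apply Cmod_triangle|]. rewrite !Cmod_mult, !Cmod_R, !Rabs_pos_eq by lra.
    assert (G1 := Cmod_ge_0 z1). assert (G2 := Cmod_ge_0 z2).
    destruct (Req_dec t 0) as [->|N]; nra. }
  split; [|apply g_sum_near_1; exact Dom].
  apply (cder_minus extremal (fun z => z)). apply cder_extremal; exact Dom. apply cder_id. }
rewrite E in B. replace (extremal z2 - z2 - (extremal z2 - z1))%C with (- (z2 - z1))%C in B by ring.
rewrite Cmod_opp in B. assert (G := Cmod_ge_0 (z2 - z1)).
assert (Z : (z2 - z1)%C = RtoC 0) by (apply Cmod_eq_0; lra).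
replace z2 with ((z2 - z1) + z1)%C by ring. rewrite Z. ring.
Qed.

Lemma normalized_expansion_extremal : normalized_expansion extremal extremal_coef.
Proof.
split; [reflexivity|]. split.
- simpl. rewrite g_coef_0. f_equal. field.
- intros z Hz. exact (proj2 (is_pseries_cseries _ _ _) (power_series_extremal z Hz)).
Qed.

Lemma extremal_in_class : class_C_arcsin extremal.
Proof.
split.
- split; [|exact extremal_univalent]. split.
  + intros z Hz. eexists. apply cder_extremal. exact Hz.
  + exists extremal_coef. exact normalized_expansion_extremal.
- exists (fun z => z ^ 3)%C. split.
  + split; [|split].
    * intros z _. eexists. apply (cder_pow 2).
    * simpl. ring.
    * intros z Hz. unfold unit_disc in Hz. rewrite Cmod_pow. assert (G := Cmod_ge_0 z).
      rewrite <- (pow1 3). apply pow_incr. lra.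
  + intros z Hz. unfold unit_disc in Hz.
    assert (E1 : forall y, Cmod y < 1 -> C_derive extremal y = g_sum y).
    { intros y Hy. apply is_C_derive_unique. exact (cder_extremal y Hy). }
    assert (E2 : C_derive (C_derive extremal) z = g_sum' z).
    { apply is_C_derive_unique.
      apply (cder_ext_loc g_sum (C_derive extremal) z (g_sum' z) (1 - Cmod z)); [lra| |].
      - intros y Hy. symmetry. apply E1. replace y with ((y - z) + z)%C by ring.
        eapply Rle_lt_trans; [apply Cmod_triangle|]. lra.
      - apply (power_series_derive _ _ power_series_g). exact Hz. }
    cbv beta. rewrite E2, E1, g_sum_ode by exact Hz. field. apply g_sum_neq_0. exact Hz.
Qed.

Theorem theorem3p9 :
  (forall (f : C -> C) (a : nat -> C),
     class_C_arcsin f -> normalized_expansion f a ->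
     Cmod (a 2%nat * a 3%nat - a 4%nat)%C <= 1 / (6 * PI)) /\
  (exists (f : C -> C) (a : nat -> C),
     class_C_arcsin f /\ normalized_expansion f a /\
     Cmod (a 2%nat * a 3%nat - a 4%nat)%C = 1 / (6 * PI)).
Proof.
split; [exact a2a3_a4_bound|].
exists extremal, extremal_coef.
split; [exact extremal_in_class|]. split; [exact normalized_expansion_extremal|].
(* Here a_2 = a_3 = 0 and a_4 = g_3 / 4 = 1 / (6 PI). *)
unfold extremal_coef. rewrite g_coef_1, g_coef_2, g_coef_3, <- RtoC_mult, <- RtoC_minus, Cmod_R.
assert (H := PI_RGT_0). rewrite Rabs_left1.
- simpl INR. field. lra.
- simpl INR. assert (0 < 2 / (3 * PI)) by (apply Rdiv_lt_0_compat; lra). lra.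
Qed.
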